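(* Let $a=(a_i)_{i\in\mathbb Z}$ be the special parameter sequence $a_i=i-\tfrac12$. For every Young diagram $\mu$, let $FS_\mu$ denote the unique element of $\Lambda$ such that for every Young diagram $\nu=(p_1,\dots,p_d\mid q_1,\dots,q_d)$ with $|\nu|=n\ge m=|\mu|$, $$\frac{\dim(\mu,\nu)}{\dim\nu}=\frac{FS_\mu(p_1+\tfrac12,\dots,p_d+\tfrac12;\,q_1+\tfrac12,\dots,q_d+\tfrac12)}{n(n-1)\cdots(n-m+1)}$$ (such an element exists, is unique, and has the form $s_\mu+{}$lower degree terms). Then $FS_\mu=s_{\mu;a}$ for every Young diagram $\mu$.
   Context: $\Lambda$ is the algebra of symmetric functions over $\mathbb C$, with complete homogeneous symmetric functions $h_k$, elementary symmetric functions $e_k$, power sums $\mathbf p_k$ and Schur functions $s_\mu$. For a sequence $a=(a_i)_{i\in\mathbb Z}$ of complex numbers define $h_{k;a}\in\Lambda$ for $k\ge1$ by $h_{k;a}=\sum_{i=1}^k(-1)^{k-i}e_{k-i}(a_1,\dots,a_{k-1})h_i$ (equivalently, $1+\sum_{k\ge1}\frac{h_{k;a}}{(u-a_1)\cdots(u-a_k)}=1+\sum_{k\ge1}h_ku^{-k}$ in $\Lambda[[u^{-1}]]$); set $h_{0;a}=1$ and $h_{k;a}=0$ for $k<0$. For $r\in\mathbb Z$ let $\tau^ra$ be the sequence $(\tau^ra)_i=a_{i+r}$. The multiparameter Schur function is $s_{\mu;a}=\det[h_{\mu_i-i+j;\,\tau^{1-j}a}]_{i,j=1}^N$ for any $N\ge\ell(\mu)$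 (the number of rows of $\mu$). Each $f\in\Lambda$ is identified with a function $f(x;y)$ of two vectors $x=(x_1,x_2,\dots)$, $y=(y_1,y_2,\dots)$ with finitely many nonzero coordinates, via the algebra homomorphism $\mathbf p_k\mapsto\sum_ix_i^k+(-1)^{k-1}\sum_jy_j^k$; for $x\in\mathbb C^m,y\in\mathbb C^n$, $f(x;y)$ means evaluation with all further coordinates set to $0$. Frobenius notation: a Young diagram $\nu$ with $d$ diagonal boxes is written $\nu=(p_1,\dots,p_d\mid q_1,\dots,q_d)$ with $p_i=\nu_i-i$, $q_i=\nu'_i-i$, where $\nu'$ is the transposed diagram; for $\nu=\varnothing$ the evaluation point is $(0;0)$. $\dim(\mu,\nu)$ is the number of standard tableaux of skew shape $\nu/\mu$ if $\mu\subseteq\nu$ and $0$ otherwise; $\dim\nu=\dim(\varnothing,\nu)$. *)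

(* Defs.v *)
From HB Require Import structures.
From mathcomp Require Import all_boot all_order all_algebra.
From mathcomp Require Import finmap.
From mathcomp Require Import monalg.

Set Implicit Arguments.
Unset Strict Implicit.
Unset Printing Implicit Defensive.

Import Order.TTheory GRing.Theory Num.Theory.
Local Open Scope ring_scope.

Definition is_part (s : seq nat) : bool := sorted geq s && (0%N \notin s).

(* transposed diagram, 0-based: conj nu j = #{r | nu_r > j} = nu'_(j+1) *)
Definition conj_part (nu : seq nat) (j : nat) : nat := count (fun r => j < r)%N nu.

Definition diag_len (nu : seq nat) : nat :=
  count (fun i => i < nth 0%N nu i)%N (iota 0 (size nu)).

(* Frobenius coordinates p_i = nu_i - i, q_i = nu'_i - i (1-based i = 1..d) *)
Definition frob_p (nu : seq nat) : seq nat :=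
  [seq (nth 0%N nu i - i.+1)%N | i <- iota 0 (diag_len nu)].
Definition frob_q (nu : seq nat) : seq nat :=
  [seq (conj_part nu i - i.+1)%N | i <- iota 0 (diag_len nu)].

Definition subdiag (mu nu : seq nat) : bool :=
  [forall i : 'I_(size mu), nth 0%N mu i <= nth 0%N nu i]%N.

Section Skew.
Variables mu nu : seq nat.
Let N := (sumn nu).+1.
Let k := (sumn nu - sumn mu)%N.

(* cell (row c.1, column c.2), 0-based, belongs to nu/mu *)
Definition in_skew (c : 'I_N * 'I_N) : bool :=
  (c.2 < nth 0%N nu c.1)%N && (nth 0%N mu c.1 <= c.2)%N.

(* T numbers the cells of nu/mu bijectively by 1..k (cells outside get 0),
   strictly increasing along rows and down columns. *)
Definition is_syt (T : {ffun 'I_N * 'I_N -> 'I_k.+1}) : bool :=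
  [forall c, ~~ in_skew c ==> (T c == ord0)] &&
  [forall c, in_skew c ==> (T c != ord0)] &&
  [forall c, forall c', [&& in_skew c, in_skew c' & T c == T c'] ==> (c == c')] &&
  [forall c, forall c', [&& in_skew c, in_skew c', c.1 == c'.1 & (c.2 < c'.2)%N]
                          ==> (T c < T c')%N] &&
  [forall c, forall c', [&& in_skew c, in_skew c', c.2 == c'.2 & (c.1 < c'.1)%N]
                          ==> (T c < T c')%N].

Definition dimsk : nat := if subdiag mu nu then #|[set T | is_syt T]| else 0%N.
End Skew.

Definition dimY (nu : seq nat) : nat := dimsk [::] nu.

(* Lambda over C: the free polynomial algebra C[p_1, p_2, ...] on the  *)
(* power sums; the variable indexed by k : nat is p_(k+1).              *)
Definition Lam (C : comRingType) := {malg C[cmonom nat]}.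

Definition psum (C : comRingType) (k : nat) : Lam C := << ucm (k.-1 : nat) >>.

(* complete homogeneous symmetric functions via Newton's identities
   k h_k = sum_(r=1..k) p_r h_(k-r), h_0 = 1 *)
Fixpoint hlist (C : fieldType) (n : nat) : seq (Lam C) :=
  match n with
  | 0 => [:: 1]
  | n'.+1 => let l := hlist C n' in
      rcons l ((n'.+1)%:R^-1 *: \sum_(r < n'.+1) psum C r.+1 * nth 0 l (n' - r))
  end.
Definition hcomp (C : fieldType) (k : nat) : Lam C := nth 0 (hlist C k) k.

Definition esym (C : comRingType) (s : seq C) (r : nat) : C :=
  \sum_(I : {set 'I_(size s)} | #|I| == r) \prod_(i in I) s`_i.

Definition hpar (C : fieldType) (a : int -> C) (k : int) : Lam C :=
  match k with
  | Posz 0 => 1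
  | Posz (S k') =>
      \sum_(1 <= i < k'.+2)
        ((-1) ^+ (k'.+1 - i) * esym [seq a (Posz j) | j <- iota 1 k'] (k'.+1 - i))
          *: hcomp C i
  | Negz _ => 0
  end.

Definition tau (C : Type) (r : int) (a : int -> C) : int -> C := fun i => a (i + r).

(* multiparameter Schur function, N = l(mu):
   s_{mu;a} = det [ h_{mu_i - i + j ; tau^{1-j} a} ]  (1-based i,j) *)
Definition mpschur (C : fieldType) (a : int -> C) (mu : seq nat) : Lam C :=
  \det (\matrix_(i < size mu, j < size mu)
          hpar (tau (- (j : nat)%:Z) a) ((nth 0%N mu i)%:Z - (i : nat)%:Z + (j : nat)%:Z)).

Definition pval (C : comRingType) (x y : seq C) (k : nat) : C :=
  \sum_(xi <- x) xi ^+ k + (-1) ^+ k.-1 * \sum_(yj <- y) yj ^+ k.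

Definition ev (C : comRingType) (x y : seq C) (f : Lam C) : C :=
  mmap id (fun m : cmonom nat =>
             \prod_(i <- finsupp (cmonom_val m)) pval x y i.+1 ^+ (m i)) f.

Definition ahalf (C : fieldType) : int -> C := fun i => i%:~R - 2^-1.

Definition FS_prop (C : fieldType) (mu : seq nat) (F : Lam C) : Prop :=
  forall nu : seq nat, is_part nu -> (sumn mu <= sumn nu)%N ->
    (dimsk mu nu)%:R / (dimY nu)%:R
    = ev [seq (p%:R + 2^-1 : C) | p <- frob_p nu]
         [seq (q%:R + 2^-1 : C) | q <- frob_q nu] F
      / ((sumn nu) ^_ (sumn mu))%:R.

(* Main.v *)
Require Import Defs.
From HB Require Import structures.
From mathcomp Require Import all_boot all_order all_algebra.
From mathcomp Require Import finmap.
From mathcomp Require Import monalg.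
From mathcomp Require Import separable cyclic cyclotomic.
From mathcomp Require Import ring zify.

(* Let l_i = nu_i + M - i and m_j = mu_j + M - j be the beta-numbers of nu and
   mu, with M + 1 rows.  Removing the largest entry of a standard filling gives
   a recursion which det [1 / (l_i - m_j)!] also satisfies, whence Aitken's
   formula for dim(mu, nu) and dim nu.  Clearing the factorials l_i!, the ratio
   n(n-1)...(n-m+1) dim(mu, nu) / dim nu is the quotient of the determinants of
   falling factorials det [l_i^(m_j)] / det [l_i^(M - j)].

   On the other side, with y_i = nu_i - i - 1/2 and b_i = - i - 1/2 the power
   sums take the value sum_i (y_i^k - b_i^k) at the Frobenius coordinates of nu,
   so h_k takes, for k > 0, the value of the divided difference of
   x^(k-1) prod_i (x - b_i) at the points y_i.  For a_i = i - 1/2 this turns the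
   values of h_(m-M+j; tau^(-j) a) into sum_i l_i^(m) w_ij, with w independent of
   m; thus the Jacobi-Trudi determinants for mu and for the empty diagram are
   the two determinants above times the same constant det w, and the second
   Jacobi-Trudi determinant is 1.

   Uniqueness: an element of Lambda vanishing at all large diagrams vanishes,
   freeing the row lengths one by one, at all values of the power sums of
   complex points, and these are arbitrary since C is algebraically closed. *)

Set Implicit Arguments.
Unset Strict Implicit.
Unset Printing Implicit Defensive.

Import Order.TTheory GRing.Theory Num.Theory.
Local Open Scope ring_scope.

(** * Divided differences and Newton's identities *)

Section DividedDifference.
Variable K : fieldType.
Implicit Types (s : seq K) (f g : K -> K).

(** Lagrange form of the divided difference at the nodes [s]. It has this meaning for duplicate-free
    [s]: the product omits every entry equal to [x]. *)
Definition divdiff s f : K := \sum_(x <- s) f x / \prod_(z <- s | z != x) (x - z).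

Lemma eq_divdiff s f g : {in s, f =1 g} -> divdiff s f = divdiff s g.
Proof. by move=> fg; apply: eq_big_seq => x xs; rewrite fg. Qed.

Lemma divdiffD s f g : divdiff s (fun x => f x + g x) = divdiff s f + divdiff s g.
Proof. by rewrite -big_split; apply: eq_bigr => x _; rewrite mulrDl. Qed.

Lemma divdiffZ s c f : divdiff s (fun x => c * f x) = c * divdiff s f.
Proof. by rewrite mulr_sumr; apply: eq_bigr => x _; rewrite mulrA. Qed.

Lemma divdiff_sum s (I : Type) (r : seq I) (F : I -> K -> K) :
  divdiff s (fun x => \sum_(i <- r) F i x) = \sum_(i <- r) divdiff s (F i).
Proof.
by rewrite exchange_big; apply: eq_bigr => x _; rewrite mulr_suml.
Qed.

Lemma perm_divdiff s t f : perm_eq s t -> divdiff s f = divdiff t f.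
Proof.
move=> st; rewrite /divdiff (perm_big t st).
by apply: eq_bigr => x _; rewrite (perm_big t st).
Qed.

(** The factor [x - y] kills the term at [y] and cancels the factor [x - y] in every other
    denominator. *)
Lemma divdiff_subl y s f : y \notin s ->
  divdiff (y :: s) (fun x => (x - y) * f x) = divdiff s f.
Proof.
move=> ys; rewrite /divdiff big_cons subrr !mul0r add0r.
apply: eq_big_seq => x xs; rewrite big_cons.
have yx : y != x by apply: contraNneq ys => ->.
have xy0 : x - y != 0 by rewrite subr_eq0 eq_sym.
by rewrite yx -mulf_div divff // mul1r.
Qed.

(** Write [y - z] as [(x - z) - (x - y)]: each summand removes one of the nodes [y], [z], and the
    two remaining divided differences agree by induction. *)
Lemma divdiff1 s : uniq s -> (0 < size s)%N ->
  divdiff s (fun=> 1) = (size s == 1%N)%:R.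
Proof.
have [n] := ubnP (size s); elim: n => // n IHn in s *.
case: s => [|y [|z s]] //= sz; first by rewrite /divdiff !big_cons !big_nil eqxx addr0 divr1.
rewrite inE negb_or => /andP[/andP[yz ys] /andP[zs us]] _.
have yz0 : y - z != 0 by rewrite subr_eq0.
apply: (mulfI yz0); rewrite -divdiffZ.
have -> : divdiff [:: y, z & s] (fun=> (y - z) * 1)
        = divdiff [:: y, z & s] (fun x => (x - z) * 1 + -1 * ((x - y) * 1)).
  by apply: eq_divdiff => x _; ring.
rewrite divdiffD divdiffZ divdiff_subl ?inE ?negb_or ?yz //.
have -> : divdiff [:: y, z & s] (fun x => (x - z) * 1)
        = divdiff (z :: y :: s) (fun x => (x - z) * 1).
  by apply: perm_divdiff; rewrite (perm_catCA [:: y] [:: z] s).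
rewrite divdiff_subl ?inE ?negb_or 1?eq_sym ?yz //.
by rewrite !IHn //= ?ys ?zs //; ring.
Qed.

Lemma divdiff_exp s m : uniq s -> (m < size s)%N ->
  divdiff s (fun x => x ^+ m) = (size s == m.+1)%:R.
Proof.
elim: m s => [|m IHm] s us ms; first by rewrite divdiff1.
case: s us ms => //= y s /andP[ys us] ms.
transitivity (divdiff (y :: s) (fun x => (x - y) * x ^+ m + y * x ^+ m)).
  by apply: eq_divdiff => x _; rewrite exprS; ring.
rewrite divdiffD divdiffZ divdiff_subl // !IHm /= ?ys //; last lia.
(* The summand [y * x ^+ m] contributes nothing, its degree being too small for the nodes
   [y :: s]. *)
by rewrite eqSS; case: (size s =P m) => [e|_]; [lia | rewrite mulr0 addr0].
Qed.

Lemma divdiff_poly s (p : {poly K}) : uniq s -> (0 < size s)%N ->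
  (size p <= size s)%N -> divdiff s (horner p) = p`_(size s).-1.
Proof.
move=> us s0 ps.
transitivity (divdiff s (fun x => \sum_(i < size s) p`_i * x ^+ i)).
  apply: eq_divdiff => x _; exact: horner_coef_wide.
rewrite divdiff_sum.
have lt : ((size s).-1 < size s)%N by rewrite ltn_predL.
rewrite (bigD1 (Ordinal lt)) //= divdiffZ divdiff_exp // prednK // eqxx mulr1.
rewrite big1 ?addr0 // => i; rewrite -val_eqE /= => ne.
rewrite divdiffZ divdiff_exp //.
by case: eqP => [e|]; [case/eqP: ne; lia | rewrite mulr0].
Qed.

End DividedDifference.

Section Newton.
Variable K : fieldType.
Implicit Types (g p : nat -> K) (bs s : seq K).

(** With G the generating series of [g] and P that of [p] from degree 1 on, this says t G' = P G. *)
Definition newton g p : Prop :=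
  forall k, k%:R * g k = \sum_(r < k) p r.+1 * g (k - r.+1)%N.

(* Coefficients of [(1 - b t) * g]. *)
Definition mul_linear (b : K) g : nat -> K :=
  fun k => g k - b * (if k is k'.+1 then g k' else 0).

(** Coefficientwise form of bt/(1 - bt) times (1 - bt) G = bt G; the sum telescopes. *)
Lemma sum_expr_mul_linear b g k :
  \sum_(r < k) b ^+ r.+1 * mul_linear b g (k - r.+1)%N
  = b * (if k is k'.+1 then g k' else 0).
Proof.
case: k => [|k]; first by rewrite big_ord0 mulr0.
transitivity (\sum_(0 <= r < k.+1) (- (b ^+ r.+2 * (if (k - r)%N is m.+1 then g m else 0))
   - - (b ^+ r.+1 * g (k - r)%N))).
  rewrite big_mkord; apply: eq_bigr => r _; rewrite subSS /mul_linear.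
  by rewrite (exprS b r.+1); ring.
rewrite (@telescope_sumr_eq _ _ _ (fun r => - (b ^+ r.+1 * (if (k.+1 - r)%N is m.+1 then g m else 0)))) //.
- by rewrite subnn subn0; ring.
- move=> r /andP[_ rk]; rewrite subSS.
  by have -> : (k.+1 - r)%N = (k - r).+1 by lia.
Qed.

(** For G1 = (1 - bt) G and P1 = P - bt/(1 - bt) one has t G1' - P1 G1 = (1 - bt)(t G' - P G). This
    one identity serves both for multiplying and for dividing by 1 - bt. *)
Lemma newton_defect_mul_linear b g p k :
  k%:R * mul_linear b g k
    - \sum_(r < k) (p r.+1 - b ^+ r.+1) * mul_linear b g (k - r.+1)%N
  = (k%:R * g k - \sum_(r < k) p r.+1 * g (k - r.+1)%N)
    - b * (if k is k'.+1 then
             k'%:R * g k' - \sum_(r < k') p r.+1 * g (k' - r.+1)%N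
           else 0).
Proof.
have -> : \sum_(r < k) (p r.+1 - b ^+ r.+1) * mul_linear b g (k - r.+1)%N
  = \sum_(r < k) p r.+1 * g (k - r.+1)%N
    - b * \sum_(r < k) p r.+1 * (if (k - r.+1)%N is m.+1 then g m else 0)
    - b * (if k is k'.+1 then g k' else 0).
  rewrite -sum_expr_mul_linear mulr_sumr -!sumrB; apply: eq_bigr => r _.
  by rewrite {1}/mul_linear mulrBl mulrBr [p _ * (b * _)]mulrCA.
case: k => [|k]; first by rewrite !big_ord0 /mul_linear; ring.
have -> : \sum_(r < k.+1) p r.+1 * (if (k.+1 - r.+1)%N is m.+1 then g m else 0)
   = \sum_(r < k) p r.+1 * g (k - r.+1)%N.
  rewrite big_ord_recr /= subnn mulr0 addr0; apply: eq_bigr => r _.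
  have -> : (k.+1 - r.+1 = (k - r.+1).+1)%N by have := ltn_ord r; lia.
  by [].
by rewrite /mul_linear -natr1; ring.
Qed.

Lemma newton_mul_linear b g p : newton g p ->
  newton (mul_linear b g) (fun r => p r - b ^+ r).
Proof.
move=> gp k; apply/eqP; rewrite -subr_eq0 newton_defect_mul_linear gp subrr sub0r.
by case: k => [|k]; rewrite ?gp ?subrr mulr0 oppr0.
Qed.

Lemma newton_div_linear y g p : newton (mul_linear y g) p ->
  newton g (fun r => p r + y ^+ r).
Proof.
move=> gp k; apply/eqP; rewrite -subr_eq0; apply/eqP.
set q := fun r => p r + y ^+ r.
have def := newton_defect_mul_linear y g q.
have zero j : j%:R * mul_linear y g j
    - \sum_(r < j) (q r.+1 - y ^+ r.+1) * mul_linear y g (j - r.+1)%N = 0.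
  rewrite gp; apply/eqP; rewrite subr_eq0; apply/eqP; apply: eq_bigr => r _.
  by rewrite /q addrK.
(* Division by 1 - yt, degree by degree: each defect is [y] times the preceding one. *)
elim: k => [|k IHk]; first by rewrite big_ord0 mul0r subrr.
by have := def k.+1; rewrite zero /= [X in _ - y * X]IHk mulr0 subr0 => <-.
Qed.

Lemma eq_newton g p q : newton g p -> (forall r, (0 < r)%N -> p r = q r) -> newton g q.
Proof. by move=> gp pq k; rewrite gp; apply: eq_bigr => r _; rewrite pq. Qed.

(** The complete homogeneous polynomial h_k of the distinct numbers in [s]. The empty list is set
    apart because its divided differences are all 0 while h_0 = 1. *)
Definition complete_divdiff (s : seq K) (k : nat) : K :=
  if s is [::] then (k == 0%N)%:R else divdiff s (fun x => x ^+ (k + (size s).-1)).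

Lemma newton_complete_divdiff s : uniq s ->
  newton (complete_divdiff s) (fun r => \sum_(x <- s) x ^+ r).
Proof.
elim: s => [_ k|y s IHs /= /andP[ys us]].
  rewrite big1; first by case: k => [|k]; rewrite ?mul0r ?mulr0.
  by move=> r _; rewrite big_nil mul0r.
suff N : newton (mul_linear y (complete_divdiff (y :: s)))
               (fun r => \sum_(x <- s) x ^+ r).
  by apply: eq_newton (newton_div_linear N) _ => r _; rewrite big_cons addrC.
(* Multiplying by 1 - yt removes the node [y], because x^(k+1) - y x^k contains the factor x - y. *)
have e j : mul_linear y (complete_divdiff (y :: s)) j = complete_divdiff s j.
  rewrite /mul_linear; case: j => [|j].
    rewrite mulr0 subr0 /= add0n divdiff_exp //= ?ys // eqxx.
    case: s us {ys IHs} => // z s us.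
    by rewrite /= add0n divdiff_exp //= eqxx.
  rewrite /complete_divdiff -divdiffZ.
  apply/eqP; rewrite subr_eq addrC; apply/eqP.
  case: s us ys {IHs} => [|z s] us ys.
    by rewrite /= /divdiff !big_cons !big_nil eqxx !addr0 !divr1 !addn0 exprS.
  rewrite -(divdiff_subl _ ys) -divdiffD; apply: eq_divdiff => x _ /=.
  by rewrite addSn !addnS exprS; ring.
by move=> k; rewrite e IHs //; apply: eq_bigr => r _; rewrite e.
Qed.

(* Coefficients of [prod_(b <- bs) (1 - b t) / prod_(y <- s) (1 - y t)]. *)
Definition super_complete (bs s : seq K) : nat -> K :=
  foldr mul_linear (complete_divdiff s) bs.

Lemma newton_super_complete bs s : uniq s ->
  newton (super_complete bs s)
    (fun r => \sum_(x <- s) x ^+ r - \sum_(b <- bs) b ^+ r).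
Proof.
move=> us; elim: bs => [|b bs IHb].
  apply: eq_newton (newton_complete_divdiff us) _ => r _.
  by rewrite big_nil subr0.
apply: eq_newton (newton_mul_linear b IHb) _ => r _.
by rewrite big_cons /=; ring.
Qed.

Lemma super_complete0 bs s : uniq s -> super_complete bs s 0 = 1.
Proof.
move=> us; elim: bs => [|b bs IHb]; last by rewrite /= /mul_linear mulr0 subr0.
case: s us => [//|y s] us; rewrite /super_complete /= add0n.
by rewrite divdiff_exp //= eqxx.
Qed.

(** Each factor 1 - bt replaces x^(k+1) by x^(k+1) - b x^k = x^k (x - b). The bound on [size bs]
    keeps the subtraction in the exponent from truncating. *)
Lemma super_completeE bs s k : uniq s -> (0 < size s)%N -> (size bs < k + size s)%N ->
  super_complete bs s k
  = divdiff s (fun x => x ^+ (k + (size s).-1 - size bs) * \prod_(b <- bs) (x - b)).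
Proof.
move=> us s0; elim: bs k => [|b bs IHb] k lk.
  rewrite /super_complete /=; case: s us s0 lk => // y s us _ _.
  by apply: eq_divdiff => x _; rewrite big_nil mulr1 subn0.
case: k lk => [|k] lk; last first.
  rewrite -[LHS]/(super_complete bs s k.+1 - b * super_complete bs s k).
  move: lk => /= lk; rewrite !IHb; [|exact: lk|exact: ltnW lk].
  rewrite -divdiffZ; apply/eqP; rewrite subr_eq addrC -divdiffD; apply/eqP.
  apply: eq_divdiff => x _; rewrite big_cons.
  have -> : (k.+1 + (size s).-1 - (size bs).+1 = k + (size s).-1 - size bs)%N by lia.
  have -> : (k.+1 + (size s).-1 - size bs = (k + (size s).-1 - size bs).+1)%N by lia.
  by rewrite exprS; ring.
(* For [k = 0] there is no preceding coefficient to recur on; instead the value 1 is the top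
   coefficient of a monic polynomial of degree [size s - 1]. *)
rewrite super_complete0 //.
set c := b :: bs in lk *.
pose P := 'X^((size s).-1 - size c) * \prod_(b <- c) ('X - b%:P).
have szP : size P = size s.
  rewrite size_Mmonic ?monic_prod_XsubC ?monic_neq0 ?monicXn //.
  by rewrite size_polyXn size_prod_XsubC; lia.
have monP : P \is monic by rewrite monicMl ?monicXn // monic_prod_XsubC.
have -> : divdiff s (fun x => x ^+ (0 + (size s).-1 - size c) * \prod_(b <- c) (x - b))
   = divdiff s (horner P).
  apply: eq_divdiff => x _; rewrite add0n hornerM hornerXn horner_prod; congr (_ * _).
  by apply: eq_bigr => z _; rewrite hornerXsubC.
rewrite divdiff_poly ?szP //; move/monicP: monP; rewrite /lead_coef szP //.
Qed.

End Newton.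

(** * Partitions and Frobenius coordinates *)

(** A downward closed predicate holds on an initial segment, whose length is the count. *)
Lemma ltn_count_initial (P : pred nat) n i : (forall j, P j.+1 -> P j) ->
  (i < count P (iota 0 n))%N = (i < n)%N && P i.
Proof.
move=> Pdown; have Ple j k : (j <= k)%N -> P k -> P j.
  elim: k => [|k IHk]; first by rewrite leqn0 => /eqP->.
  by rewrite leq_eqVlt ltnS => /predU1P[->|/IHk h /Pdown].
elim: n i => // n IHn i; have -> : iota 0 n.+1 = iota 0 n ++ [:: n] by rewrite -addn1 iotaD.
rewrite count_cat /= addn0.
case Pn: (P n); last first.
  rewrite addn0 IHn ltnS [in RHS]leq_eqVlt.
  by case: eqP => [->|]; rewrite ?Pn ?ltnn.
have -> : count P (iota 0 n) = n.
  apply/eqP; rewrite eqn_leq -{2}(size_iota 0 n) count_size /= leqNgt.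
  apply/negP => lt; have := IHn (count P (iota 0 n)).
  by rewrite ltnn lt (Ple _ n) // ltnW.
by rewrite addn1; case: ltnP => //; rewrite ltnS => /Ple->.
Qed.

Lemma nth_le_sumn s i : (nth 0 s i <= sumn s)%N.
Proof.
elim: s i => [|a s IHs] [|i] //=; first exact: leq_addr.
by apply: leq_trans (IHs i) _; exact: leq_addl.
Qed.

Section Partition.
Variable nu : seq nat.
Hypothesis part_nu : is_part nu.

Lemma part_nth_le i j : (i <= j)%N -> (nth 0 nu j <= nth 0 nu i)%N.
Proof.
move=> ij; have [szj|szj] := leqP (size nu) j; first by rewrite nth_default.
case/andP: part_nu => so _.
have tr : transitive geq by move=> x y z /= h1 h2; apply: leq_trans h2 h1.
apply: (sorted_leq_nth tr (fun x => leqnn x) 0%N so) => //; rewrite inE.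
exact: leq_ltn_trans szj.
Qed.

Lemma part_size_le_sumn : (size nu <= sumn nu)%N.
Proof.
case/andP: part_nu => _; elim: nu => //= a s IHs; rewrite inE negb_or eq_sym.
by case/andP=> a0 /IHs; rewrite -lt0n in a0; lia.
Qed.

Lemma ltn_conj_part r c : (r < conj_part nu c)%N = (c < nth 0 nu r)%N.
Proof.
rewrite /conj_part -{1}(mkseq_nth 0%N nu) count_map.
rewrite (@ltn_count_initial (preim (nth 0%N nu) (fun r => c < r)%N)) /=.
  by case: ltnP => // h; rewrite nth_default.
by move=> j /leq_trans -> //; apply: part_nth_le.
Qed.

Lemma ltn_diag_len i : (i < diag_len nu)%N = (i < nth 0 nu i)%N.
Proof.
rewrite /diag_len (@ltn_count_initial (fun i => i < nth 0 nu i)%N).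
  by case: ltnP => // h; rewrite nth_default.
move=> j h; apply: leq_trans (part_nth_le (leqnSn j)); exact: ltnW.
Qed.

End Partition.

(** The window is a condition inside the fixed range up to [M], so that sums over rows and columns
    of a diagram can be exchanged. *)
Lemma telescope_sumr_window (V : zmodType) (phi : nat -> V) a b M : (b <= M)%N ->
  \sum_(0 <= c < M | (a <= c)%N && (c < b)%N) (phi c.+1 - phi c)
  = if (a <= b)%N then phi b - phi a else 0.
Proof.
move=> bM; rewrite -(@big_nat_widen _ _ _ 0 b M) //.
case: leqP => [ab|ba].
  by rewrite -(@big_nat_widenl _ _ _ a 0 b predT) // telescope_sumr.
rewrite big_nat_cond big1 // => c; rewrite andbC => /and3P[]; lia.
Qed.

(* Both sides sum [G (c+1-r) - G (c-r)], [G t = (t - 1/2)^k], over the cells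
   [(r, c)] of the diagram: by principal hooks on the left, by rows on the right. *)
Lemma pval_frobenius (C : numFieldType) (nu : seq nat) N k :
  is_part nu -> (size nu <= N)%N -> (0 < k)%N ->
  pval [seq (p%:R + 2^-1 : C) | p <- frob_p nu]
       [seq (q%:R + 2^-1 : C) | q <- frob_q nu] k
  = \sum_(i < N) ((nth 0%N nu i)%:R - i%:R - 2^-1) ^+ k
    - \sum_(i < N) (- i%:R - 2^-1) ^+ k.
Proof.
move=> part_nu szN k0.
pose G (t : C) := (t - 2^-1) ^+ k.
pose d := diag_len nu; pose M := (N + sumn nu)%N.
have nuM i : (nth 0 nu i <= M)%N by have := nth_le_sumn nu i; lia.
have conjM c : (conj_part nu c <= M)%N.
  by rewrite (leq_trans (count_size _ _)) //; lia.
have dM : (d <= M)%N.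
  by rewrite (leq_trans (count_size _ _)) // size_iota; lia.
pose D (r c : nat) := G (c.+1%:R - r%:R) - G (c%:R - r%:R).
pose cells := \sum_(0 <= r < M) \sum_(0 <= c < M | (c < nth 0 nu r)%N) D r c.
transitivity cells; last first.
  rewrite -sumrB -(big_mkord predT (fun i => ((nth 0%N nu i)%:R - i%:R - 2^-1) ^+ k
    - (- i%:R - 2^-1 : C) ^+ k)).
  rewrite (@big_nat_widen _ _ _ 0 N M) ?leq_addr // [RHS]big_mkcond /cells.
  apply: eq_bigr => r _.
  rewrite (telescope_sumr_window (fun c => G (c%:R - r%:R)) 0) //= /G sub0r.
  by case: ltnP => // Nr; rewrite nth_default ?(leq_trans szN) // sub0r subrr.
rewrite {}/cells.
(* In the i-th principal hook the arm with the diagonal cell telescopes to G(nu_i - i) - G(0), the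
   leg to G(0) - G(i + 1 - nu'_i), with 0-based indices. *)
transitivity (\sum_(0 <= i < M | (i < d)%N) (G ((nth 0 nu i)%:R - i%:R) - G 0)
  + \sum_(0 <= i < M | (i < d)%N) (G 0 - G (i.+1%:R - (conj_part nu i)%:R))).
  rewrite -big_split /= -(@big_nat_widen _ _ _ 0 d M predT) // /pval !big_map.
  rewrite /index_iota subn0 mulr_sumr -big_split /=; apply: eq_big_seq => i.
  rewrite mem_iota add0n -/(d) => /andP[_ id].
  have inu : (i < nth 0 nu i)%N by rewrite -ltn_diag_len.
  have icj : (i < conj_part nu i)%N by rewrite ltn_conj_part.
  rewrite /G addrA subrK !natrB //.
  have -> : (-1) ^+ k.-1 * ((conj_part nu i)%:R - i.+1%:R + 2^-1) ^+ k
     = - (i.+1%:R - (conj_part nu i)%:R - 2^-1 : C) ^+ k.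
    have -> : i.+1%:R - (conj_part nu i)%:R - 2^-1
       = - ((conj_part nu i)%:R - i.+1%:R + 2^-1) :> C by ring.
    have e : (-1) ^+ k = - (-1) ^+ k.-1 :> C by rewrite -{1}(prednK k0) exprS mulN1r.
    by rewrite [in RHS]exprNn e mulNr opprK.
  by congr (_ ^+ k - _); rewrite -natr1; field.
(* Cells with [r <= c] form the arms and are summed along rows; cells with [c < r] form the legs and
   are summed down columns, after exchanging the sums. *)
transitivity (\sum_(0 <= r < M) (\sum_(0 <= c < M | (r <= c)%N && (c < nth 0 nu r)%N) D r c
   + \sum_(0 <= c < M | (c < r)%N && (c < nth 0 nu r)%N) D r c)); last first.
  apply: eq_bigr => r _; rewrite [RHS](bigID (fun c => r <= c)%N) /=; congr (_ + _).
    by apply: eq_bigl => c; rewrite andbC.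
  by apply: eq_bigl => c; rewrite -ltnNge andbC.
rewrite [RHS]big_split /=; congr (_ + _).
  rewrite big_mkcond; apply: eq_bigr => r _ /=.
  rewrite (telescope_sumr_window (fun c => G (c%:R - r%:R))) // subrr ltn_diag_len //.
  by case: ltngtP => // e; rewrite -e !subrr.
rewrite (exchange_big_dep predT) //= big_mkcond; apply: eq_bigr => c _ /=.
transitivity (\sum_(0 <= r < M | (c.+1 <= r)%N && (r < conj_part nu c)%N)
    (- G (c.+1%:R - r.+1%:R) - - G (c.+1%:R - r%:R))).
  rewrite (telescope_sumr_window (fun r => - G (c.+1%:R - r%:R))) // subrr.
  by rewrite ltn_diag_len // ltn_conj_part //; case: ifP => // _; rewrite opprK addrC.
apply: eq_big => [r|r _]; first by rewrite ltn_conj_part.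
rewrite /D opprK addrC; congr (_ - G _); rewrite -!natr1; ring.
Qed.

(** * Counting standard fillings *)

Lemma nonincreasing_le (g : nat -> nat) i j :
  (forall k, (g k.+1 <= g k)%N) -> (i <= j)%N -> (g j <= g i)%N.
Proof.
move=> gm; elim: j => [|j IHj]; first by rewrite leqn0 => /eqP->.
rewrite leq_eqVlt => /predU1P[->//|]; rewrite ltnS => /IHj.
exact: leq_trans.
Qed.

Section StandardFillings.
Variable M : nat.
Local Notation cell := ('I_M.+1 * 'I_M.+1)%type.
Implicit Types (S : pred cell) (t : cell -> nat) (f g : nat -> nat) (c : cell).

(** Labels are natural numbers without a bound in the type, so one predicate covers fillings before
    and after a cell is removed. *)
Definition standard S t : Prop :=
  [/\ forall c, ~~ S c -> t c = 0%N,
      forall c, S c -> (0 < t c)%N,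
      forall c c', S c -> S c' -> t c = t c' -> c = c',
      forall c c', S c -> S c' -> c.1 = c'.1 -> (c.2 < c'.2)%N -> (t c < t c')%N
    & forall c c', S c -> S c' -> c.2 = c'.2 -> (c.1 < c'.1)%N -> (t c < t c')%N].

Definition skew_cell f g c : bool := (c.2 < g c.1)%N && (f c.1 <= c.2)%N.

(** The clauses repeat those of [is_syt], so that [dimsk] is convertible to this count. Row lengths
    are functions, which makes removing a box a pointwise operation. *)
Definition standardb f g K (T : {ffun cell -> 'I_K.+1}) : bool :=
  [forall c, ~~ skew_cell f g c ==> (T c == ord0)] &&
  [forall c, skew_cell f g c ==> (T c != ord0)] &&
  [forall c, forall c', [&& skew_cell f g c, skew_cell f g c' & T c == T c'] ==> (c == c')] &&
  [forall c, forall c', [&& skew_cell f g c, skew_cell f g c', c.1 == c'.1 & (c.2 < c'.2)%N]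
                          ==> (T c < T c')%N] &&
  [forall c, forall c', [&& skew_cell f g c, skew_cell f g c', c.2 == c'.2 & (c.1 < c'.1)%N]
                          ==> (T c < T c')%N].

Definition count_standard K f g : nat := #|[set T | @standardb f g K T]|.

Lemma standardP f g K (T : {ffun cell -> 'I_K.+1}) :
  reflect (standard (skew_cell f g) (fun c => T c : nat)) (standardb f g T).
Proof.
apply: (iffP idP).
  case/andP=> /andP[/andP[/andP[hz hp] hi] hr] hc; split.
  - by move=> c nc; move/forallP/(_ c): hz; rewrite nc => /eqP->.
  - by move=> c nc; move/forallP/(_ c): hp; rewrite nc lt0n.
  - move=> c c' sc sc' e; move/forallP/(_ c)/forallP/(_ c'): hi.
    by rewrite sc sc' /= -val_eqE /= e eqxx => /eqP.
  - move=> c c' sc sc' e lt; move/forallP/(_ c)/forallP/(_ c'): hr.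
    by rewrite sc sc' e eqxx lt.
  - move=> c c' sc sc' e lt; move/forallP/(_ c)/forallP/(_ c'): hc.
    by rewrite sc sc' e eqxx lt.
case=> hz hp hi hr hc; rewrite /standardb -!andbA; apply/and5P; split.
- by apply/forallP => c; apply/implyP => /hz h; apply/eqP/val_inj.
- by apply/forallP => c; apply/implyP => /hp h; rewrite -val_eqE -lt0n.
- apply/forallP => c; apply/forallP => c'; apply/implyP => /and3P[sc sc' /eqP e].
  by apply/eqP/hi => //; rewrite e.
- apply/forallP => c; apply/forallP => c'; apply/implyP => /and4P[sc sc' /eqP e lt].
  exact: hr.
- apply/forallP => c; apply/forallP => c'; apply/implyP => /and4P[sc sc' /eqP e lt].
  exact: hc.
Qed.

Lemma eq_standard S S' t t' : S =1 S' -> t =1 t' -> standard S t -> standard S' t'.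
Proof.
move=> eS et [hz hp hi hr hc]; split.
- by move=> c; rewrite -eS -et; apply: hz.
- by move=> c; rewrite -eS -et; apply: hp.
- by move=> c c'; rewrite -!eS -!et; apply: hi.
- by move=> c c'; rewrite -!eS -!et; apply: hr.
- by move=> c c'; rewrite -!eS -!et; apply: hc.
Qed.

Lemma standard_shrink S t c0 : standard S t ->
  standard (fun c => S c && (c != c0)) (fun c => if c == c0 then 0%N else t c).
Proof.
case=> hz hp hi hr hc; split.
- by move=> c; case: eqP => // _; rewrite andbT; apply: hz.
- by move=> c /andP[sc /negPf->]; apply: hp.
- by move=> c c' /andP[sc /negPf->] /andP[sc' /negPf->]; apply: hi.
- by move=> c c' /andP[sc /negPf->] /andP[sc' /negPf->]; apply: hr.
- by move=> c c' /andP[sc /negPf->] /andP[sc' /negPf->]; apply: hc.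
Qed.

Lemma standard_extend S t c0 K : S c0 ->
  (forall c, S c -> c.1 = c0.1 -> (c.2 <= c0.2)%N) ->
  (forall c, S c -> c.2 = c0.2 -> (c.1 <= c0.1)%N) ->
  (forall c, (t c <= K)%N) ->
  standard (fun c => S c && (c != c0)) t ->
  standard S (fun c => if c == c0 then K.+1 else t c).
Proof.
move=> S0 right below tK [hz hp hi hr hc]; split.
- move=> c nS; case: eqP => [e|_]; first by rewrite e S0 in nS.
  by apply: hz; rewrite (negPf nS).
- by move=> c sc; case: eqP => // /eqP ne; apply: hp; rewrite sc.
- move=> c c' sc sc'; case: eqP => [->|/eqP ne]; case: eqP => [->|/eqP ne'] //.
  + by move=> e; have := tK c'; rewrite -e ltnn.
  + by move=> e; have := tK c; rewrite e ltnn.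
  + by apply: hi; rewrite ?sc ?sc'.
- move=> c c' sc sc' e lt; case: (c =P c0) => [e0|/eqP ne].
    by have := right c' sc' _; rewrite -e e0 => /(_ erefl); rewrite leqNgt -e0 lt.
  case: (c' =P c0) => [_|/eqP ne']; first by rewrite ltnS.
  by apply: hr; rewrite ?sc ?sc'.
- move=> c c' sc sc' e lt; case: (c =P c0) => [e0|/eqP ne].
    by have := below c' sc' _; rewrite -e e0 => /(_ erefl); rewrite leqNgt -e0 lt.
  case: (c' =P c0) => [_|/eqP ne']; first by rewrite ltnS.
  by apply: hc; rewrite ?sc ?sc'.
Qed.

Definition remove_box g (i : nat) : nat -> nat := fun r => (g r - (r == i))%N.

Definition corner f g (i : nat) : bool := (g i.+1 < g i)%N && (f i < g i)%N.

Definition row_end g (i : 'I_M.+1) : cell := (i, inord (g i).-1).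

(** Pigeonhole: K + 1 cells carry distinct nonzero labels, and only K such labels remain if the
    largest is avoided. *)
Lemma standard_max f g K (T : {ffun cell -> 'I_K.+2}) :
  standardb f g T -> #|skew_cell f g| = K.+1 ->
  exists2 c, skew_cell f g c & T c = ord_max.
Proof.
move=> /standardP[hz hp hi hr hc] cardS.
case: (pickP (fun c => skew_cell f g c && (T c == ord_max))) => [c /andP[sc /eqP]|no].
  by exists c.
have : (#|T @: skew_cell f g| <= #|~: [set (ord0 : 'I_K.+2); ord_max]|)%N.
  apply/subset_leq_card/subsetP => v /imsetP[c sc ->]; rewrite !inE negb_or.
  apply/andP; split; first by rewrite -val_eqE /= -lt0n hp.
  by have := no c; rewrite -[skew_cell f g c]/(c \in skew_cell f g) sc /= => ->.
rewrite card_in_imset; last by move=> c c' sc sc' e; apply: hi => //; rewrite e.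
by rewrite cardS cardsCs setCK cards2 card_ord subn2 ltnn.
Qed.

Lemma card_skew_cell f g : (forall i, (g i <= M.+1)%N) ->
  #|skew_cell f g| = (\sum_(i < M.+1) (g i - f i))%N.
Proof.
move=> gM; rewrite -sum1_card.
transitivity (\sum_(i < M.+1) \sum_(j < M.+1 | (j < g i)%N && (f i <= j)%N) 1)%N.
  by rewrite pair_big_dep /=; apply: eq_bigl => -[i j].
apply: eq_bigr => i _; rewrite -(big_mkord (fun j => (j < g i)%N && (f i <= j)%N) (fun=> 1%N)).
transitivity (\sum_(f i <= j < g i) 1)%N; last by rewrite sum_nat_const_nat muln1.
rewrite (@big_nat_widen _ _ _ (f i) (g i) M.+1) //.
by rewrite (@big_nat_widenl _ _ _ (f i) 0%N M.+1).
Qed.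

Section Recursion.
Variables f g : nat -> nat.
Hypothesis f_mono : forall i, (f i.+1 <= f i)%N.
Hypothesis g_mono : forall i, (g i.+1 <= g i)%N.
Hypothesis g_le : forall i, (g i <= M.+1)%N.
Hypothesis g_out : forall i, (M < i)%N -> g i = 0%N.

Lemma row_end_val (i : 'I_M.+1) : (0 < g i)%N -> (row_end g i).2 = (g i).-1 :> nat.
Proof. by move=> gi; rewrite /= inordK //; have := g_le i; lia. Qed.

Lemma skew_row_end (i : 'I_M.+1) : corner f g i -> skew_cell f g (row_end g i).
Proof. by case/andP=> _ fg; rewrite /skew_cell row_end_val /=; lia. Qed.

Lemma skew_remove_box (i : 'I_M.+1) : corner f g i ->
  (fun c => skew_cell f g c && (c != row_end g i)) =1 skew_cell f (remove_box g i).
Proof.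
move=> ci c; have gi : (0 < g i)%N by case/andP: ci; lia.
have -> : (c == row_end g i) = (c.1 == i) && (c.2 == (g i).-1 :> nat).
  by rewrite -(row_end_val gi); case: c => a b; rewrite xpair_eqE.
rewrite /skew_cell /remove_box; case: (c.1 =P i) => [e|ne] /=.
  by rewrite e eqxx; lia.
have -> : (c.1 == i :> nat) = false by apply/eqP => e; apply/ne/val_inj.
by rewrite subn0 andbT.
Qed.

(** A skew cell to the right of [c] or below it would need a label above the maximum. *)
Lemma standard_max_corner K (T : {ffun cell -> 'I_K.+2}) c :
  standardb f g T -> skew_cell f g c -> T c = ord_max ->
  corner f g c.1 /\ c = row_end g c.1.
Proof.
move=> /standardP[hz hp hi hr hc] sc Tc.
have Tmax c' : ~ (T c < T c')%N by rewrite Tc /= => h; have := ltn_ord (T c'); lia.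
case: c sc Tc Tmax => i j sc Tc Tmax; case/andP: (sc) => /= ji fj.
have right : (g i <= j.+1)%N.
  rewrite leqNgt; apply/negP => lt.
  have jM : (j.+1 < M.+1)%N by have := g_le i; lia.
  apply: (Tmax (i, Ordinal jM)); apply: hr => //=.
  by rewrite /skew_cell /=; lia.
have below : (g i.+1 <= j)%N.
  rewrite leqNgt; apply/negP => lt.
  have iM : (i.+1 < M.+1)%N.
    by rewrite ltnS ltnNge; apply/negP => h; move: lt; rewrite g_out.
  apply: (Tmax (Ordinal iM, j)); apply: hc => //=.
  by rewrite /skew_cell /=; have := f_mono i; lia.
split; first by rewrite /corner /=; lia.
by congr pair; apply: val_inj; rewrite /= inordK //=; have := g_le i; lia.
Qed.

(** Erasing the largest label is a bijection; its inverse [ext] writes [K.+1] back at the end of row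
    [i]. *)
Lemma card_standard_at_corner K (i : 'I_M.+1) : corner f g i ->
  #|[set T : {ffun cell -> 'I_K.+2} | standardb f g T && (T (row_end g i) == ord_max)]|
  = count_standard K f (remove_box g i).
Proof.
move=> ci; set c0 := row_end g i.
have skc0 := skew_row_end ci.
have skd := skew_remove_box ci.
have gi : (0 < g i)%N by case/andP: ci; lia.
pose ext (T : {ffun cell -> 'I_K.+1}) : {ffun cell -> 'I_K.+2} :=
  [ffun c => inord (if c == c0 then K.+1 else T c)].
have extE T c : ext T c = (if c == c0 then K.+1 else T c) :> nat.
  by rewrite ffunE inordK //; case: ifP => // _; have := ltn_ord (T c); lia.
have ext_inj : {in [set T | standardb f (remove_box g i) T] &, injective ext}.
  move=> T T'; rewrite !inE => /standardP[z _ _ _ _] /standardP[z' _ _ _ _] e.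
  apply/ffunP => c; apply: val_inj => /=.
  have := congr1 (fun U : {ffun cell -> 'I_K.+2} => val (U c)) e.
  rewrite /= !extE; case: eqP => // -> _.
  by rewrite z ?z' // -skd eqxx andbF.
rewrite /count_standard -(card_in_imset ext_inj); apply: eq_card => T.
rewrite !inE; apply/andP/imsetP.
  case=> stT /eqP Tc0; exists [ffun c => inord (if c == c0 then 0%N else T c)].
    rewrite inE; apply/standardP.
    have [hz hp hi hr hc] := standardP _ _ _ stT.
    apply: eq_standard (standard_shrink c0 (standardP _ _ _ stT)) => // c.
    rewrite ffunE inordK //; case: eqP => // ne; have := ltn_ord (T c).
    rewrite ltnS leq_eqVlt ltnS => /predU1P[TK|//].
    have [sc|nsc] := boolP (skew_cell f g c); last by rewrite hz.
    by case: ne; apply: hi => //; rewrite TK Tc0.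
  apply/ffunP => c; apply: val_inj => /=; rewrite extE ffunE.
  case: eqP => [->|ne]; first by rewrite Tc0.
  have [hz hp hi hr hc] := standardP _ _ _ stT.
  rewrite inordK //; have := ltn_ord (T c).
  rewrite ltnS leq_eqVlt ltnS => /predU1P[TK|//].
  have [sc|nsc] := boolP (skew_cell f g c); last by rewrite hz.
  by case: ne; apply: hi => //; rewrite TK Tc0.
case=> T'; rewrite inE => /standardP stT' ->; split; last first.
  by rewrite -val_eqE /= extE eqxx.
apply/standardP.
apply: (@eq_standard (skew_cell f g) _ (fun c => if c == c0 then K.+1 else T' c)) => //.
apply: standard_extend => //.
- move=> c /andP[h _] e; rewrite row_end_val //; rewrite e /= in h; lia.
- move=> c /andP[h _] e; rewrite leqNgt; apply/negP => /= lt.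
  have h2 : (g c.1 <= g i.+1)%N by apply: nonincreasing_le.
  rewrite e row_end_val // in h; case/andP: ci; lia.
- by move=> c; rewrite -ltnS.
- by apply: eq_standard stT' => // c; rewrite skd.
Qed.

(* Remove the cell carrying the largest entry. *)
Lemma count_standardS K : #|skew_cell f g| = K.+1 ->
  count_standard K.+1 f g
  = (\sum_(i < M.+1 | corner f g i) count_standard K f (remove_box g i))%N.
Proof.
move=> cardS.
under eq_bigr => i ci do rewrite -card_standard_at_corner //.
under eq_bigr => i ci do rewrite -sum1_card.
under eq_bigr => i ci.
  rewrite (eq_bigl (fun T => standardb f g T && (T (row_end g i) == ord_max))); last first.
    by move=> T; rewrite inE.
  rewrite big_mkcondr /=.
  over.
rewrite exchange_big /= /count_standard -sum1_card.
apply: eq_big => [T|T]; rewrite inE // => stT.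
(* Each filling is counted exactly once: its maximum sits at one corner only. *)
have [c sc Tc] := standard_max stT cardS.
have [cc ce] := standard_max_corner stT sc Tc.
rewrite (bigD1 c.1) //= -ce Tc eqxx big1 // => i /andP[ci ne].
case: eqP => // e; case/eqP: ne.
have [_ _ hi _ _] := standardP _ _ _ stT.
by have := hi _ _ (skew_row_end ci) sc; rewrite e Tc => /(_ erefl) <-.
Qed.

End Recursion.

Lemma count_standard0 f g : (forall i, (g i <= f i)%N) -> count_standard 0 f g = 1%N.
Proof.
move=> gf; apply/eqP/cards1P; exists [ffun => ord0]; apply/setP => T; rewrite !inE.
apply/idP/eqP => [_|->]; first by apply/ffunP => c; rewrite ffunE ord1.
have no c : skew_cell f g c = false by rewrite /skew_cell; have := gf c.1; lia.
by apply/standardP; split=> c; rewrite ?ffunE // no.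
Qed.

End StandardFillings.

(** * Aitken's determinant *)

Section ScaledRows.
Import mathcomp.fingroup.perm.

(** In the term of a permutation s the scalars add up to the sum of u_i - v_(s i), which does not
    depend on s. *)
Lemma sum_det_row_scaled (R : comNzRingType) n (A : 'M[R]_n) (u v : 'I_n -> R) :
  \sum_i \det (\matrix_(r, c) ((if r == i then u r - v c else 1) * A r c))
  = (\sum_i u i - \sum_j v j) * \det A.
Proof.
rewrite /determinant exchange_big mulr_sumr /=; apply: eq_bigr => s _.
transitivity (\sum_i (-1) ^+ s * ((u i - v (s i)) * \prod_r A r (s r))).
  apply: eq_bigr => i _; congr (_ * _).
  under eq_bigr do rewrite mxE.
  rewrite big_split /= (bigD1 i) //= eqxx [\prod_(_ < _ | _ != _) _]big1 ?mulr1 //.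
  by move=> j /negPf->.
rewrite -mulr_sumr -mulr_suml sumrB [\sum_j v j](reindex_inj (@perm_inj _ s)) /=.
by rewrite mulrCA.
Qed.

End ScaledRows.

Section Aitken.
Import mathcomp.fingroup.perm.
Variables (C : numFieldType) (M : nat).
Implicit Types f g : nat -> nat.

(** The zero branch is explicit because truncated subtraction would give 1/0! = 1 for [l < m]. *)
Definition inv_fact (l m : nat) : C := if (m <= l)%N then (l - m)`!%:R^-1 else 0.

Definition beta g (i : 'I_M.+1) : nat := (g i + (M - i))%N.

Definition aitken f g : C := \det (\matrix_(i, j) inv_fact (beta g i) (beta f j)).

(** Scaling a row of Aitken's matrix by l_i - m_j thus lowers l_i by one, that is, removes a box
    from row [i]. For [m = l + 1] both sides vanish. *)
Lemma inv_fact_pred l m : (l.+1%:R - m%:R) * inv_fact l.+1 m = inv_fact l m.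
Proof.
rewrite /inv_fact; case: (leqP m l) => [ml|lm].
  rewrite (leq_trans ml) // subSn // factS -natrB ?(leq_trans ml) // subSn //.
  by rewrite natrM invfM mulrA divff ?mul1r // pnatr_eq0.
case: ifP => ml; last by rewrite mulr0.
by have -> : m = l.+1 by [lia]; rewrite subrr mul0r.
Qed.

(* A zero block of size (n - i) x (i + 1) forces a zero in every permutation. *)
Lemma aitken_eq0 f g (i : 'I_M.+1) :
  (forall k, (f k.+1 <= f k)%N) -> (forall k, (g k.+1 <= g k)%N) ->
  (g i < f i)%N -> aitken f g = 0.
Proof.
move=> fm gm gf; rewrite /aitken /determinant big1 // => s _.
have [r ri sri] : exists2 r : 'I_M.+1, (i <= r)%N & (s r <= i)%N.
  apply/exists_inP; apply: contraT; rewrite negb_exists_in => /forall_inP no.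
  have : (#|s @: [set r : 'I_M.+1 | (i <= r)%N]| <= #|[set r : 'I_M.+1 | (i < r)%N]|)%N.
    apply/subset_leq_card/subsetP => c /imsetP[r]; rewrite !inE => ir ->.
    by rewrite ltnNge no.
  rewrite card_imset; last exact: perm_inj.
  rewrite leqNgt => /negP[]; apply: proper_card; apply/properP; split.
    by apply/subsetP => r; rewrite !inE => /ltnW.
  by exists i; rewrite !inE ?ltnn.
rewrite (bigD1 r) //= mxE /inv_fact ifF ?mul0r ?mulr0 //.
apply/negP; rewrite /beta; have := nonincreasing_le gm ri; have := nonincreasing_le fm sri.
have := ltn_ord r; lia.
Qed.

Lemma aitken_diag f : (forall k, (f k.+1 <= f k)%N) -> aitken f f = 1.
Proof.
move=> fm; rewrite /aitken -det_tr det_trig.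
  by rewrite big1 // => i _; rewrite !mxE /inv_fact leqnn subnn fact0 invr1.
apply/is_trig_mxP => i j ij; rewrite !mxE /inv_fact ifF //; apply/negP.
rewrite /beta; have := nonincreasing_le fm (ltnW ij); have := ltn_ord j; lia.
Qed.

(** Apply [sum_det_row_scaled] with the beta-numbers: the scalar becomes the number of cells, and
    scaling row [i] gives the determinant with a box removed there if [i] is a corner, and 0
    otherwise. *)
Lemma aitken_rec f g :
  (forall k, (f k.+1 <= f k)%N) -> (forall k, (g k.+1 <= g k)%N) ->
  (forall k, (M < k)%N -> g k = 0%N) -> (forall k, (f k <= g k)%N) ->
  (\sum_(i < M.+1) (g i - f i))%N%:R * aitken f g
  = \sum_(i < M.+1 | corner f g i) aitken f (remove_box g i).
Proof.
move=> fm gm gout fg.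
pose scaled (i : 'I_M.+1) : C := \det (\matrix_(r, c)
  ((if r == i then (beta g r)%:R - (beta f c)%:R else 1) *
     (\matrix_(i, j) inv_fact (beta g i) (beta f j)) r c)).
have pos (i : 'I_M.+1) : (0 < g i)%N -> scaled i = aitken f (remove_box g i).
  move=> gi; congr (\det _); apply/matrixP => r c; rewrite !mxE /remove_box /beta.
  case: (r =P i) => [->|ne]; last first.
    have -> : (r == i :> nat) = false by apply/eqP => e; apply/ne/val_inj.
    by rewrite subn0 mul1r.
  rewrite eqxx; have -> : (g i + (M - i) = (g i - 1 + (M - i)).+1)%N by lia.
  exact: inv_fact_pred.
have -> : (\sum_(i < M.+1) (g i - f i))%N%:R
   = \sum_i (beta g i)%:R - \sum_i (beta f i)%:R :> C.
  rewrite -sumrB natr_sum; apply: eq_bigr => i _.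
  by rewrite natrB // /beta !natrD; ring.
rewrite /aitken -sum_det_row_scaled [RHS]big_mkcond; apply: eq_bigr => i _.
rewrite -/(scaled i) -/(aitken f (remove_box g i)).
case: ifP => [/andP[gi _]|]; first by apply: pos; lia.
rewrite /corner => /negbT; rewrite negb_and -!leqNgt.
case: (ltnP (g i.+1) (g i)) => [lt|eqg] /=.
  (* Row [i] of [g] equals that of [f]: after the removal [f] no longer fits inside. *)
  move=> gf; rewrite pos; last lia.
  apply: (@aitken_eq0 _ _ i) => //.
    move=> k; rewrite /remove_box; have := gm k.
    by case: (k =P i) => [->|_]; case: (k.+1 =P i) => [|_]; lia.
  by rewrite /remove_box eqxx; lia.
have {}eqg : g i.+1 = g i by apply/eqP; rewrite eqn_leq gm eqg.
(* Rows [i] and [i + 1] of [g] are equal: the lowered beta-number meets the next one, giving two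
   equal rows. For [i = M] the beta-number is 0 and the scaled row vanishes. *)
move=> _; case: (ltnP i M) => [iM|Mi].
  pose i' : 'I_M.+1 := Ordinal (iM : (i.+1 < M.+1)%N).
  apply: (@determinant_alternate _ _ _ i i'); first by rewrite -val_eqE /= neq_ltn leqnn.
  move=> c; rewrite !mxE eqxx -val_eqE /=.
  have -> : (i.+1 == i) = false by lia.
  rewrite mul1r.
  have -> : beta g i' = (g i + (M - i.+1))%N by rewrite /beta /= eqg.
  have -> : beta g i = (g i + (M - i.+1)).+1 by rewrite /beta; lia.
  exact: inv_fact_pred.
rewrite /scaled (expand_det_row _ i) big1 // => c _; rewrite !mxE eqxx.
have -> : beta g i = 0%N.
  by rewrite /beta -eqg gout //=; apply/eqP; rewrite subn_eq0.
rewrite /inv_fact; case: (beta f c) => [|m] /=; rewrite ?leqn0 ?subrr ?mul0r //.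
by rewrite mulr0 mul0r.
Qed.

Lemma sum_remove_box f g K (i : 'I_M.+1) : (f i < g i)%N ->
  (\sum_(i < M.+1) (g i - f i))%N = K.+1 ->
  (\sum_(r < M.+1) (remove_box g i r - f r))%N = K.
Proof.
move=> fg; rewrite (bigD1 i) //= => sK; rewrite (bigD1 i) //= /remove_box eqxx.
rewrite (eq_bigr (fun r : 'I_M.+1 => g r - f r)%N).
  by rewrite -[LHS]/(g i - 1 - f i + _)%N; lia.
move=> r ne; have -> : (r == i :> nat) = false by apply/negbTE.
by rewrite subn0.
Qed.

(** Induction on the number [K] of cells: [count_standardS] and [aitken_rec] are the same recursion
    over corners up to the factor K, absorbed by the factorial. *)
Lemma count_standard_aitken K f g :
  (forall k, (f k.+1 <= f k)%N) -> (forall k, (g k.+1 <= g k)%N) ->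
  (forall k, (g k <= M.+1)%N) ->
  (forall k, (M < k)%N -> g k = 0%N) -> (forall k, (f k <= g k)%N) ->
  (\sum_(i < M.+1) (g i - f i))%N = K ->
  (count_standard M K f g)%:R = K`!%:R * aitken f g.
Proof.
move=> fm; elim: K g => [|K IHK] g gm gM gout fg sumK.
  have gf k : (g k <= f k)%N.
    have [kM|Mk] := ltnP k M.+1; last by rewrite gout.
    move/eqP: sumK; rewrite sum_nat_eq0 => /forall_inP/(_ (Ordinal kM) isT).
    by rewrite /= subn_eq0.
  rewrite count_standard0 //.
  have -> : aitken f g = aitken f f.
    congr (\det _); apply/matrixP => i j; rewrite !mxE /beta.
    by have -> : g i = f i by apply/eqP; rewrite eqn_leq fg gf.
  by rewrite aitken_diag // mul1r.
rewrite count_standardS //; last by rewrite card_skew_cell.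
rewrite factS natrM mulrAC -sumK aitken_rec // mulr_suml natr_sum.
apply: eq_bigr => i ci; rewrite mulrC; case/andP: (ci) => gi fgi.
have rb k : remove_box g i k = if k == i :> nat then (g i).-1 else g k.
  by rewrite /remove_box; case: eqP => [->|_]; rewrite ?subn1 ?subn0.
apply: IHK => //.
- move=> k; have := gm k; rewrite !rb.
  case: (k =P i) => [->|_]; first by rewrite ifF; lia.
  by case: (_ =P _) => [<-|//]; lia.
- by move=> k; rewrite (leq_trans _ (gM k)) // leq_subr.
- by move=> k /gout; rewrite /remove_box => ->.
- by move=> k; rewrite rb; case: eqP => [->|_]; [lia | exact: fg].
- exact: sum_remove_box.
Qed.

End Aitken.

Lemma sumn_nth_wide s N : (size s <= N)%N -> sumn s = (\sum_(i < N) nth 0 s i)%N.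
Proof.
move=> sN; rewrite sumnE (big_nth 0%N) -(big_mkord predT) (@big_nat_widen _ _ _ 0%N (size s) N) //.
rewrite [RHS](bigID (fun i => i < size s)%N) /= [X in (_ + X)%N]big1 ?addn0 //.
by move=> i; rewrite -leqNgt => h; rewrite nth_default.
Qed.

(** The |nu| + 1 rows match the square of cells in [dimsk]. If [mu] is not contained in [nu], the
    determinant vanishes by [aitken_eq0]. *)
Lemma dimsk_aitken (C : numFieldType) mu nu : is_part mu -> is_part nu ->
  (sumn mu <= sumn nu)%N ->
  (dimsk mu nu)%:R
  = (sumn nu - sumn mu)`!%:R * aitken C (sumn nu) (nth 0%N mu) (nth 0%N nu).
Proof.
move=> pm pn le.
have mm k : (nth 0 mu k.+1 <= nth 0 mu k)%N by apply: part_nth_le.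
have nm k : (nth 0 nu k.+1 <= nth 0 nu k)%N by apply: part_nth_le.
have szm := part_size_le_sumn pm; have szn := part_size_le_sumn pn.
rewrite /dimsk; case: ifP => [/forallP sub|/negbT]; last first.
  rewrite negb_forall => /existsP[i]; rewrite -ltnNge => lt.
  have iN : (i < (sumn nu).+1)%N by have := ltn_ord i; lia.
  by rewrite (@aitken_eq0 _ _ _ _ (Ordinal iN)) // mulr0.
have sub' k : (nth 0 mu k <= nth 0 nu k)%N.
  have [kM|Mk] := ltnP k (size mu); first exact: (sub (Ordinal kM)).
  by rewrite nth_default.
rewrite -count_standard_aitken //.
- by move=> k; rewrite (leq_trans (nth_le_sumn nu k)).
- by move=> k Mk; rewrite nth_default // (leq_trans szn) // ltnW.
- have := @sumn_nth_wide nu _ (leqW szn).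
  have := @sumn_nth_wide mu _ (leqW (leq_trans szm le)).
  have : (\sum_(i < (sumn nu).+1) (nth 0 nu i - nth 0 mu i)
     + \sum_(i < (sumn nu).+1) nth 0 mu i = \sum_(i < (sumn nu).+1) nth 0 nu i)%N.
    by rewrite -big_split; apply: eq_bigr => i _; rewrite /= subnK.
  lia.
Qed.

(** * Evaluation of multiparameter Schur functions *)

Section MonomialEvaluation.
Variables (R : comNzRingType) (v : nat -> R).
Local Open Scope fset_scope.

Definition cmonom_eval (m : cmonom nat) : R :=
  \prod_(i <- finsupp (cmonom_val m)) v i ^+ (m i).

Lemma cmonom_evalEw (d : {fset nat}) m : finsupp (cmonom_val m) `<=` d ->
  cmonom_eval m = \prod_(i <- d) v i ^+ (m i).
Proof.
move=> sd; rewrite /cmonom_eval; apply: big_fset_incl => // i _ im.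
by move: im; rewrite -cmE_eq0 => /eqP->.
Qed.

Lemma cmonom_eval_mmorphism : mmorphism cmonom_eval.
Proof.
split=> [m1 m2|]; last by rewrite /cmonom_eval mdom1 big_seq_fset0.
pose d := finsupp (cmonom_val m1) `|` finsupp (cmonom_val m2).
rewrite (@cmonom_evalEw d) ?mdomD // (@cmonom_evalEw d m1) ?fsubsetUl //.
rewrite (@cmonom_evalEw d m2) ?fsubsetUr // -big_split; apply: eq_bigr => i _ /=.
by rewrite cmM exprD.
Qed.

HB.instance Definition _ := isMultiplicative.Build (cmonom nat) R cmonom_eval
  cmonom_eval_mmorphism.

Lemma cmonom_evalU i : cmonom_eval (ucm i) = v i.
Proof. by rewrite /cmonom_eval mdomU big_seq_fset1 cmUU expr1. Qed.

End MonomialEvaluation.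

(** Evaluation with an arbitrary value [v r] for the power sum of degree r + 1; [ev] is convertible
    to an instance and so inherits the ring morphism structure. *)
Definition lam_eval (C : comNzRingType) (v : nat -> C) : Lam C -> C :=
  mmap idfun (cmonom_eval v).

HB.instance Definition _ (C : comNzRingType) (v : nat -> C) :=
  GRing.RMorphism.copy (lam_eval v) (mmap idfun (cmonom_eval v)).

Section LamEval.
Variables (C : fieldType) (v : nat -> C).

Lemma lam_evalZ c f : lam_eval v (c *: f) = c * lam_eval v f.
Proof. exact: (@mmapZ _ _ _ idfun (cmonom_eval v)). Qed.

Lemma lam_eval_psum r : lam_eval v (psum C r.+1) = v r.
Proof.
have := @mmapU _ _ _ idfun (cmonom_eval v) 1 (ucm r) => /= e.
by rewrite /lam_eval /psum e cmonom_evalU mul1r.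
Qed.

Lemma size_hlist n : size (hlist C n) = n.+1.
Proof. by elim: n => //= n IHn; rewrite size_rcons IHn. Qed.

Lemma nth_hlist n k : (k <= n)%N -> nth 0 (hlist C n) k = hcomp C k.
Proof.
elim: n => [|n IHn]; first by rewrite leqn0 => /eqP->.
rewrite leq_eqVlt => /predU1P[->//|kn].
by rewrite /= nth_rcons size_hlist kn IHn.
Qed.

Lemma hcompS k : hcomp C k.+1
  = k.+1%:R^-1 *: \sum_(r < k.+1) psum C r.+1 * hcomp C (k - r)%N.
Proof.
transitivity (k.+1%:R^-1 *: \sum_(r < k.+1) psum C r.+1 * nth 0 (hlist C k) (k - r)).
  rewrite /hcomp -[hlist C k.+1]/(rcons _ _).
  by rewrite nth_rcons size_hlist ltnn eqxx.
apply: (congr1 (fun z => k.+1%:R^-1 *: z)); apply: eq_bigr => r _.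
by rewrite nth_hlist // leq_subr.
Qed.

Lemma lam_eval_hcompS k : lam_eval v (hcomp C k.+1)
  = k.+1%:R^-1 * \sum_(r < k.+1) v r * lam_eval v (hcomp C (k - r)%N).
Proof.
rewrite hcompS lam_evalZ rmorph_sum; congr (_ * _); apply: eq_bigr => r _.
by rewrite rmorphM /= lam_eval_psum.
Qed.

End LamEval.

(** In characteristic 0 Newton's identities determine the sequence from its term 0. *)
Lemma lam_eval_hcomp_newton (C : numFieldType) (g p v : nat -> C) :
  newton g p -> g 0%N = 1 -> (forall r, v r = p r.+1) ->
  forall k, lam_eval v (hcomp C k) = g k.
Proof.
move=> gp g0 vp k; have [n] := ubnP k; elim: n k => // n IHn [|k] kn.
  by rewrite /hcomp /= rmorph1 g0.
apply: (@mulfI _ k.+1%:R); first by rewrite pnatr_eq0.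
rewrite gp lam_eval_hcompS mulrA divff ?pnatr_eq0 // mul1r; apply: eq_bigr => r _.
by rewrite vp subSS IHn // (leq_ltn_trans (leq_subr _ _)).
Qed.

Lemma big_iota_ord (R : Type) (idx : R) (op : R -> R -> R) n (F : nat -> R) :
  \big[op/idx]_(i <- iota 0 n) F i = \big[op/idx]_(i < n) F i.
Proof. by rewrite -(big_mkord predT F) /index_iota subn0. Qed.

(** * Jacobi-Trudi determinants at the Frobenius coordinates of a diagram *)

Section JacobiTrudi.
Variables (C : numFieldType) (nu : seq nat) (M : nat).
Hypothesis part_nu : is_part nu.
Hypothesis nu_size : (size nu <= M.+1)%N.

Let v (r : nat) : C := pval [seq (p%:R + 2^-1 : C) | p <- frob_p nu]
       [seq (q%:R + 2^-1 : C) | q <- frob_q nu] r.+1.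
Let y (i : nat) : C := (nth 0%N nu i)%:R - i%:R - 2^-1.
Let ys := [seq y i | i <- iota 0 M.+1].
Let bs : seq C := [seq (- i%:R - 2^-1) | i <- iota 0 M.+1].

Let y_inj : {in iota 0 M.+1 &, injective y}.
Proof.
move=> i j _ _; wlog ij : i j / (i <= j)%N => [hw e|].
  by case/orP: (leq_total i j) => h; [|symmetry]; apply: hw.
move=> /addIr/eqP; rewrite subr_eq addrAC eq_sym subr_eq -!natrD eqr_nat => /eqP e.
have := part_nth_le part_nu ij; lia.
Qed.

Let uniq_ys : uniq ys.
Proof. by rewrite map_inj_in_uniq ?iota_uniq. Qed.

Lemma lam_eval_hcomp k : lam_eval v (hcomp C k) = super_complete bs ys k.
Proof.
move: k; apply: lam_eval_hcomp_newton; first exact: newton_super_complete.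
  exact: super_complete0.
move=> r; rewrite /v (pval_frobenius _ part_nu nu_size) // !big_map.
by rewrite !big_iota_ord.
Qed.

(** [bs] and [ys] have equally many entries, so the exponent in [super_completeE] is one less than
    the degree; degree 0 is therefore excluded. *)
Lemma lam_eval_hcomp_pos k : lam_eval v (hcomp C k.+1)
  = divdiff ys (fun x => x ^+ k * \prod_(b <- bs) (x - b)).
Proof.
rewrite lam_eval_hcomp super_completeE ?size_map ?size_iota //; last by rewrite addSn ltnS leq_addl.
by apply: eq_divdiff => x _; congr (_ ^+ _ * _); lia.
Qed.

(** The signed elementary symmetric functions in [hpar] are the coefficients of the product of the x
    - a_s. *)
Lemma lam_eval_hpar_pos (a : int -> C) k : lam_eval v (hpar a k.+1%:Z)
  = divdiff ys (fun x => \prod_(s <- iota 1 k) (x - a s%:Z) * \prod_(b <- bs) (x - b)).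
Proof.
pose cs := [seq a (Posz j) | j <- iota 1 k].
have szc : size cs = k by rewrite size_map size_iota.
rewrite /= rmorph_sum big_add1 /= big_mkord.
transitivity (\sum_(i < k.+1) divdiff ys (fun x =>
   ((\prod_(c <- cs) ('X - c%:P))`_i * x ^+ i) * \prod_(b <- bs) (x - b))).
  apply: eq_bigr => i _; rewrite lam_evalZ lam_eval_hcomp_pos subSS.
  rewrite -divdiffZ; apply: eq_divdiff => x _; rewrite mulrA; congr (_ * _ * _).
  rewrite coef_prod_XsubC; last by rewrite szc -ltnS.
  have -> : (size cs - i = k - i)%N by rewrite szc.
  by congr (_ * _); rewrite /esym; apply: eq_bigl => I.
rewrite -divdiff_sum; apply: eq_divdiff => x _; rewrite -mulr_suml; congr (_ * _).
rewrite -horner_coef_wide; last by rewrite size_prod_XsubC szc.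
rewrite horner_prod big_map; apply: eq_bigr => s _.
by rewrite hornerXsubC.
Qed.

Definition fallfact (z : C) n : C := \prod_(s < n) (z - s%:R).

Lemma fallfactD z m n : fallfact z (m + n) = fallfact z m * fallfact (z - m%:R) n.
Proof.
rewrite /fallfact big_split_ord /=; congr (_ * _); apply: eq_bigr => i _.
by rewrite natrD; ring.
Qed.

Lemma fallfact_nat l m : fallfact l%:R m = (l ^_ m)%:R.
Proof.
elim: m => [|m IHm]; first by rewrite /fallfact big_ord0 ffactn0.
rewrite -addn1 fallfactD IHm addn1 ffactnSr natrM /fallfact big_ord1 subr0.
case: (leqP m l) => [ml|lm]; first by rewrite natrB.
by rewrite ffact_small // !mul0r.
Qed.

(** [L] carries [y i] to the beta-number nu_i + M - i. *)
Let L (x : C) := x + M%:R + 2^-1.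

(** A monic polynomial of degree m + j at M + 1 nodes: the coefficient of x^M is extracted. This
    matches h_0 = 1 and h_k = 0 for k < 0. *)
Lemma divdiff_fallfact_small m j : (m + j <= M)%N ->
  divdiff ys (fun x => fallfact (L x) m * fallfact (L x - (M.+1 - j)%N%:R) j)
  = (M == m + j)%N%:R.
Proof.
move=> mj.
pose cs := [seq (s%:R - M%:R - 2^-1 : C) | s <- iota 0 m]
   ++ [seq (s%:R + (M.+1 - j)%N%:R - M%:R - 2^-1 : C) | s <- iota 0 j].
have szc : size cs = (m + j)%N by rewrite size_cat !size_map !size_iota.
have szy : size ys = M.+1 by rewrite size_map size_iota.
transitivity (divdiff ys (horner (\prod_(c <- cs) ('X - c%:P)))).
  apply: eq_divdiff => x _; rewrite horner_prod big_cat !big_map /=.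
  rewrite !big_iota_ord.
  by congr (_ * _); apply: eq_bigr => s _; rewrite hornerXsubC /L; ring.
rewrite divdiff_poly ?szy ?size_prod_XsubC ?szc //=.
have [->|ne] := eqVneq M (m + j)%N.
  have := monic_prod_XsubC cs predT id; rewrite monicE /lead_coef size_prod_XsubC szc.
  by move/eqP.
by rewrite nth_default // size_prod_XsubC szc; lia.
Qed.

(** On the right [m] and [j] occur in separate factors, uniformly in the sign of the index; this
    lets the Jacobi-Trudi matrix factor. *)
Lemma lam_eval_hpar m j : (j <= M)%N ->
  lam_eval v (hpar (tau (- j%:Z) (@ahalf C)) (m%:Z - M%:Z + j%:Z))
  = divdiff ys (fun x => fallfact (L x) m * fallfact (L x - (M.+1 - j)%N%:R) j).
Proof.
move=> jM; have [lt|le] := ltnP M (m + j)%N; last first.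
  rewrite divdiff_fallfact_small //.
  have [e|ne] := eqVneq M (m + j)%N.
    have -> : m%:Z - M%:Z + j%:Z = 0 by lia.
    by rewrite rmorph1.
  have -> : m%:Z - M%:Z + j%:Z = Negz (M - (m + j)).-1 by lia.
  by rewrite /= rmorph0.
pose k := (m + j - M).-1.
have -> : m%:Z - M%:Z + j%:Z = k.+1%:Z by rewrite /k; lia.
rewrite lam_eval_hpar_pos; apply: eq_divdiff => x _.
(* The factors x - b form the falling factorial of [L x] of length M + 1. It splits after M + 1 - j
   factors, and the factors x - a_s extend the first piece to length [m]. *)
have -> : m = (M.+1 - j + k)%N by rewrite /k; lia.
rewrite fallfactD mulrAC -fallfactD subnK ?(leq_trans jM) // mulrC; congr (_ * _).
  rewrite big_map big_iota_ord /fallfact [RHS](reindex_inj rev_ord_inj).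
  apply: eq_bigr => i _ /=.
  by rewrite subSS natrB ?leq_ord // /L; ring.
rewrite -[1%N]addn0 iotaDl big_map big_iota_ord; apply: eq_bigr => s _.
rewrite /tau /ahalf /L natrB ?(leq_trans jM) // -natr1.
have -> : (1 + s)%N%:Z - j%:Z = (1 + s%:Z) - j%:Z by [].
by rewrite rmorphB rmorphD /=; field.
Qed.

Definition jacobi_trudi (f : nat -> nat) : C :=
  \det (\matrix_(i < M.+1, j < M.+1)
     lam_eval v (hpar (tau (- (j : nat)%:Z) (@ahalf C)) ((f i)%:Z - (i : nat)%:Z + (j : nat)%:Z))).

(** Unitriangular, since h_0 = 1 and h_k = 0 for k < 0. This fixes the constant left open in
    [jacobi_trudi_factor]. *)
Lemma jacobi_trudi0 : jacobi_trudi (fun=> 0%N) = 1.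
Proof.
rewrite /jacobi_trudi -det_tr det_trig.
  rewrite big1 // => i _; rewrite !mxE.
  have -> : 0%:Z - (i : nat)%:Z + (i : nat)%:Z = 0 by lia.
  by rewrite rmorph1.
apply/is_trig_mxP => i j ij; rewrite !mxE.
have -> : 0%:Z - (j : nat)%:Z + (i : nat)%:Z = Negz (j - i).-1 by lia.
exact: rmorph0.
Qed.

(** By [lam_eval_hpar] the matrix is a product [V *m w] with [w] independent of [f]; since l^(m) =
    l!/(l - m)!, the transpose of [V] is Aitken's matrix with rows scaled by l_i!. *)
Lemma jacobi_trudi_factor : exists c : C, forall f,
  jacobi_trudi f = aitken C M f (nth 0%N nu) * c.
Proof.
pose w : 'M[C]_M.+1 := \matrix_(i, j)
  (fallfact (L (y i) - (M.+1 - j)%N%:R) j / \prod_(z <- ys | z != y i) (y i - z)).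
exists ((\prod_(i < M.+1) (beta (nth 0%N nu) i)`!%:R) * \det w) => f.
pose V : 'M[C]_M.+1 := \matrix_(r, i) ((beta (nth 0%N nu) i) ^_ (beta f r))%:R.
have -> : jacobi_trudi f = \det (V *m w).
  congr (\det _); apply/matrixP => r j; rewrite !mxE.
  have -> : (f r)%:Z - (r : nat)%:Z + (j : nat)%:Z
     = (beta f r)%:Z - M%:Z + (j : nat)%:Z.
    by rewrite /beta; have := ltn_ord r; lia.
  rewrite lam_eval_hpar ?leq_ord // /divdiff big_map.
  rewrite big_iota_ord; apply: eq_bigr => i _.
  rewrite !mxE mulrA; congr (_ * _ / _).
  have -> : L (y i) = (beta (nth 0%N nu) i)%:R.
    rewrite /L /y /beta natrD natrB ?leq_ord //; ring.
  exact: fallfact_nat.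
rewrite det_mulmx mulrA; congr (_ * _); rewrite -det_tr mulrC.
have -> : V^T = diag_mx (\row_i (beta (nth 0%N nu) i)`!%:R)
   *m (\matrix_(i, j) inv_fact C (beta (nth 0%N nu) i) (beta f j)).
  apply/matrixP => i j; rewrite mul_diag_mx !mxE /inv_fact.
  case: leqP => [le|lt]; last by rewrite mulr0 ffact_small.
  rewrite -(ffact_fact le) natrM mulfK // pnatr_eq0 -lt0n; exact: fact_gt0.
by rewrite det_mulmx det_diag; congr (_ * _); apply: eq_bigr => i _; rewrite mxE.
Qed.

Lemma jacobi_trudiE f :
  jacobi_trudi f * aitken C M (fun=> 0%N) (nth 0%N nu) = aitken C M f (nth 0%N nu).
Proof.
have [c Hc] := jacobi_trudi_factor; have := jacobi_trudi0; rewrite !Hc => e.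
by rewrite -mulrA [c * _]mulrC e mulr1.
Qed.

(** Its product with the constant [c] is 1. *)
Lemma aitken0_neq0 : aitken C M (fun=> 0%N) (nth 0%N nu) != 0.
Proof.
have [c Hc] := jacobi_trudi_factor; apply/eqP => e.
by have := jacobi_trudi0; rewrite Hc e mul0r => /esym/eqP; rewrite oner_eq0.
Qed.

End JacobiTrudi.

Section Stability.
Variables (C : fieldType) (a : int -> C) (mu : seq nat).

(** The size is free because evaluation at [nu] calls for |nu| + 1 rows. *)
Definition mpschur_size N : Lam C :=
  \det (\matrix_(i < N, j < N)
    hpar (tau (- (j : nat)%:Z) a) ((nth 0%N mu i)%:Z - (i : nat)%:Z + (j : nat)%:Z)).

(** The last row is (0, ..., 0, 1), its indices being negative before the diagonal. *)
Lemma mpschur_sizeS N : (size mu <= N)%N -> mpschur_size N.+1 = mpschur_size N.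
Proof.
move=> szN; rewrite {1}/mpschur_size (expand_det_row _ ord_max) (bigD1 ord_max) //= big1.
  rewrite mxE nth_default // addr0.
  have -> : 0%:Z - (ord_max : 'I_N.+1)%:Z + (ord_max : 'I_N.+1)%:Z = 0 by lia.
  rewrite mul1r /cofactor /= -signr_odd addnn odd_double expr0 mul1r.
  by congr (\det _); apply/matrixP => i j; rewrite !mxE !lift_max.
move=> j jN; rewrite mxE nth_default //=.
have {}jN : (j < N)%N by move: jN (ltn_ord j); rewrite -val_eqE /=; lia.
have -> : 0%:Z - N%:Z + (j : nat)%:Z = Negz (N - j).-1 by lia.
by rewrite mul0r.
Qed.

Lemma mpschur_sizeE N : (size mu <= N)%N -> mpschur_size N = mpschur a mu.
Proof.
move=> szN; rewrite -(subnKC szN); elim: (N - size mu)%N => [|n IHn].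
  by rewrite addn0.
by rewrite addnS mpschur_sizeS ?leq_addr.
Qed.

End Stability.

Lemma FS_prop_mpschur (C : numFieldType) mu : is_part mu ->
  FS_prop mu (mpschur (@ahalf C) mu).
Proof.
move=> pm nu pn le.
have szm := part_size_le_sumn pm; have szn := part_size_le_sumn pn.
have szm' : (size mu <= (sumn nu).+1)%N by lia.
have szn' : (size nu <= (sumn nu).+1)%N by lia.
rewrite -(mpschur_sizeE _ szm') /mpschur_size.
set e := ev _ _ _.
have -> : e = jacobi_trudi C nu (sumn nu) (nth 0%N mu).
  rewrite /e -[LHS]/(lam_eval _ _) -det_map_mx; congr (\det _).
  by apply/matrixP => i j; rewrite !mxE.
have e0 : aitken C (sumn nu) (nth 0%N [::]) (nth 0%N nu)
        = aitken C (sumn nu) (fun=> 0%N) (nth 0%N nu).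
  by congr (\det _); apply/matrixP => i j; rewrite !mxE /beta nth_nil.
rewrite /dimY !dimsk_aitken // e0 -(jacobi_trudiE C pn szn') subn0.
have a0 := aitken0_neq0 C pn szn'; rewrite -(ffact_fact le) natrM.
have f0 : (sumn nu - sumn mu)`!%:R != 0 :> C by rewrite pnatr_eq0 -lt0n fact_gt0.
have ff0 : (sumn nu ^_ sumn mu)%:R != 0 :> C by rewrite pnatr_eq0 -lt0n ffact_gt0.
by field; rewrite f0 ff0 a0.
Qed.

(** * Uniqueness *)

Lemma poly_eq0_on_nat (C : numFieldType) (p : {poly C}) (a : C) n0 :
  (forall n, (n0 <= n)%N -> p.[n%:R + a] = 0) -> p = 0.
Proof.
move=> p0; apply/eqP/negPn/negP => pn0.
pose rs := [seq n%:R + a | n <- iota n0 (size p)].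
suff : (size rs < size p)%N by rewrite size_map size_iota ltnn.
apply: max_poly_roots => //; last first.
  by rewrite map_inj_uniq ?iota_uniq // => i j /addIr/eqP; rewrite eqr_nat => /eqP.
apply/allP => x /mapP[n]; rewrite mem_iota => /andP[n0n _] ->.
by apply/rootP; apply: p0.
Qed.

(** Uniqueness of base [B] digits, by division with remainder. *)
Lemma digits_inj D B (m m' : nat -> nat) :
  (forall i, (m i < B)%N) -> (forall i, (m' i < B)%N) ->
  (\sum_(i < D) m i * B ^ i = \sum_(i < D) m' i * B ^ i)%N ->
  forall i, (i < D)%N -> m i = m' i.
Proof.
elim: D m m' => // D IHD m m' mB m'B.
have step (f : nat -> nat) : (\sum_(i < D.+1) f i * B ^ i
    = \sum_(i < D) f i.+1 * B ^ i * B + f 0)%N.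
  rewrite big_ord_recl /= expn0 muln1 addnC; congr (_ + _)%N.
  by apply: eq_bigr => i _; rewrite /bump /= add1n expnSr mulnA.
rewrite !step -!big_distrl /= => e.
have B0 : (0 < B)%N by apply: leq_ltn_trans (mB 0%N).
have e0 : m 0%N = m' 0%N.
  by have := congr1 (modn^~ B) e; rewrite !modnMDl !modn_small.
have eD : (\sum_(i < D) m i.+1 * B ^ i = \sum_(i < D) m' i.+1 * B ^ i)%N.
  by have := congr1 (divn^~ B) e; rewrite !divnMDl // !divn_small // !addn0.
case=> // i; exact: (IHD (fun j => m j.+1) (fun j => m' j.+1)
  (fun j => mB j.+1) (fun j => m'B j.+1) eD i).
Qed.

(** One bound for variable indices and exponents, so that [D] can be both the number of variables
    and the base in [lam_eval_eq0]. *)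
Lemma cmonom_bound (s : seq (cmonom nat)) : exists2 D, (0 < D)%N &
  forall m : cmonom nat, m \in s -> forall i, (m i < D)%N /\ (m i != 0%N -> (i < D)%N).
Proof.
elim: s => [|m s [D D0 HD]]; first by exists 1%N.
pose D1 := (\sum_(i <- finsupp (cmonom_val m)) (i + m i))%N.
have H1 i : m i != 0%N -> (i + m i <= D1)%N.
  by rewrite cmE_neq0 => im; rewrite /D1 (big_fsetD1 i) //= leq_addr.
exists (D + D1.+1)%N; first lia.
move=> m'; rewrite inE => /predU1P[->|/HD h] i.
  by have := H1 i; case: eqP => [->|_ /(_ isT)] /=; lia.
by have [h1 h2] := h i; split=> [|/h2]; lia.
Qed.

Section Vanishing.
Variables (C : numFieldType) (G : Lam C).

Lemma eq_lam_eval D (v v' : nat -> C) :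
  (forall m : cmonom nat, m \in msupp G -> forall i, m i != 0%N -> (i < D)%N) ->
  (forall i, (i < D)%N -> v i = v' i) -> lam_eval v G = lam_eval v' G.
Proof.
move=> HD vv'; rewrite /lam_eval /mmap; apply: eq_big_seq => m mG; congr (_ * _).
apply: eq_big_seq => i; rewrite -cmE_neq0 => mi; rewrite vv' //; exact: HD mi.
Qed.

Lemma lam_eval_horner (q : nat -> {poly C}) :
  exists Q : {poly C}, forall t, Q.[t] = lam_eval (fun r => (q r).[t]) G.
Proof.
exists (\sum_(m <- msupp G) G@_m *: cmonom_eval q m) => t.
rewrite horner_sum; apply: eq_bigr => m _; rewrite hornerZ; congr (_ * _).
by rewrite horner_prod; apply: eq_bigr => i _; rewrite horner_exp.
Qed.

(** Kronecker substitution: giving the i-th variable the value t^(D^i) turns distinct monomials of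
    [G] into distinct powers t^(w m), by uniqueness of digits. *)
Lemma lam_eval_eq0 : (forall v, lam_eval v G = 0) -> G = 0.
Proof.
move=> G0; have [D D0 HD] := cmonom_bound (msupp G).
pose w (m : cmonom nat) := (\sum_(i < D) m i * D ^ i)%N.
pose P := \sum_(m <- msupp G) G@_m *: 'X^(w m).
have P0 : P = 0.
  apply: (@poly_eq0_on_nat _ _ 0 0%N) => n _; rewrite addr0.
  rewrite -(G0 (fun i => n%:R ^+ (D ^ i)%N)) horner_sum; apply: eq_big_seq => m mG.
  rewrite hornerZ hornerXn; congr (_ * _); rewrite /cmonom_eval.
  rewrite /w expr_sum -(big_mkord predT (fun i => n%:R ^+ (m i * D ^ i)%N)).
  rewrite (eq_bigr (fun i => (n%:R ^+ (D ^ i)%N) ^+ m i)); last first.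
    by move=> i _; rewrite mulnC exprM.
  rewrite [LHS](bigID (mem (finsupp (cmonom_val m)))) /= [X in _ * X]big1 ?mulr1.
    rewrite -big_filter; apply: perm_big; apply: uniq_perm.
    - by rewrite filter_uniq // iota_uniq.
    - exact: fset_uniq.
    move=> i; rewrite mem_filter mem_index_iota leq0n /=.
    case: (boolP (i \in _)) => //; rewrite -cmE_neq0 => mi.
    by have [_ /(_ mi) ->] := HD m mG i.
  by move=> i; rewrite -cmE_eq0 => /eqP->.
apply/malgP => m; rewrite mcoeff0.
have [mG|] := boolP (m \in msupp G); last exact: mcoeff_outdom.
have := congr1 (fun p : {poly C} => p`_(w m)) P0; rewrite /P coef_sum coef0.
rewrite (bigD1_seq m) ?fset_uniq //= coefZ coefXn eqxx mulr1 big1_seq ?addr0 //.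
move=> m' /andP[ne m'G]; rewrite coefZ coefXn.
case: eqP => [e|]; rewrite ?mulr0 //; case/eqP: ne.
apply/eqP/cmP => i.
have B1 j := (HD m mG j).1; have B2 j := (HD m' m'G j).1.
have [iD|Di] := ltnP i D; first by rewrite (@digits_inj D D _ _ B1 B2 e i iD).
have z (m0 : cmonom nat) : m0 \in msupp G -> m0 i = 0%N.
  move=> m0G; apply/eqP/negPn/negP => /(HD m0 m0G i).2; lia.
by rewrite !z.
Qed.


Lemma lam_eval_ext (v v' : nat -> C) : v =1 v' -> lam_eval v G = lam_eval v' G.
Proof.
have [D _ HD] := cmonom_bound (msupp G).
by move=> vv'; apply: (@eq_lam_eval D) => // m mG i; apply: (HD m mG i).2.
Qed.

Variable m : nat.
Hypothesis vanish : forall nu, is_part nu -> (m <= sumn nu)%N ->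
  ev [seq (p%:R + 2^-1 : C) | p <- frob_p nu]
     [seq (q%:R + 2^-1 : C) | q <- frob_q nu] G = 0.

(* The rows are freed one at a time, longest first: for fixed lower rows, a
   polynomial identity in one row length holds for infinitely many integers. *)
Lemma vanish_free_rows N (zs : seq C) (tl : seq nat) :
  (0 < N)%N -> sorted geq tl -> all (ltn m) tl -> (size zs + size tl = N)%N ->
  lam_eval (fun r => \sum_(z <- zs) z ^+ r.+1
     + \sum_(i < size tl) ((nth 0%N tl i)%:R - (size zs + i)%N%:R - 2^-1) ^+ r.+1
     - \sum_(i < N) (- i%:R - 2^-1) ^+ r.+1) G = 0.
Proof.
move=> N0; elim: zs tl => [|z zs IHzs] tl so al sz.
  have pt : is_part tl.
    rewrite /is_part so /=; apply/negP => z0.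
    by have := allP al _ z0; rewrite /= ltn0.
  have le : (m <= sumn tl)%N.
    case: tl {so pt} al sz => [|t tl] /=; first by rewrite -(prednK N0).
    by case/andP=> mt _ _; lia.
  rewrite -[RHS](vanish pt le) -[RHS]/(lam_eval _ G).
  apply: lam_eval_ext => r; rewrite (pval_frobenius _ pt (leqnn _)) //.
  by rewrite big_nil add0r -sz add0n.
pose c (r : nat) := \sum_(z <- zs) z ^+ r.+1
  + \sum_(i < size tl) ((nth 0%N tl i)%:R - (size zs + i.+1)%N%:R - 2^-1) ^+ r.+1
  - \sum_(i < N) (- i%:R - 2^-1) ^+ r.+1.
have [Q HQ] := lam_eval_horner (fun r => (c r)%:P + 'X^(r.+1)).
have Q0 : Q = 0.
  apply: (@poly_eq0_on_nat _ _ (- (size zs)%:R - 2^-1) (m.+1 + head 0%N tl)%N) => n le.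
  (* As [n] exceeds [m] and the first entry of [tl], it can be prepended as a new row; it has index
     [size zs], hence the coordinate n - size zs - 1/2. *)
  have so' : sorted geq (n :: tl).
    case: tl so al le {sz c Q HQ} => //= t tl so _ le; rewrite so andbT; lia.
  have al' : all (ltn m) (n :: tl) by rewrite /= al andbT; lia.
  have sz' : (size zs + size (n :: tl) = N)%N by rewrite -sz /= addnS.
  rewrite HQ -[RHS](IHzs _ so' al' sz'); apply: lam_eval_ext => r.
  rewrite hornerD hornerC hornerXn /c /= big_ord_recl /= addn0.
  by rewrite [n%:R + (_ - _)]addrA; ring.
rewrite -[RHS](horner0 z) -Q0 HQ; apply: lam_eval_ext => r.
rewrite hornerD hornerC hornerXn /c big_cons.
have -> : \sum_(i < size tl) ((nth 0%N tl i)%:R - (size (z :: zs) + i)%N%:R - 2^-1) ^+ r.+1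
  = \sum_(i < size tl) ((nth 0%N tl i)%:R - (size zs + i.+1)%N%:R - 2^-1) ^+ r.+1 :> C.
  by apply: eq_bigr => i _; rewrite addnS.
ring.
Qed.

End Vanishing.

(** X^n - 1 splits and is separable, so it has n distinct roots, among which one is primitive. *)
Lemma primitive_root_exists (C : numClosedFieldType) n : (0 < n)%N ->
  exists z : C, n.-primitive_root z.
Proof.
move=> n_gt0; pose p : {poly C} := 'X^n - 1.
have [r Dp] := closed_field_poly_normal p.
rewrite (monicP _) ?monicXnsubC // scale1r in Dp.
have rn1 : all n.-unity_root r by apply/allP=> z; rewrite -root_prod_XsubC -Dp.
have sz_r : (n < (size r).+1)%N.
  by rewrite -(size_prod_XsubC r id) -Dp size_XnsubC.
have [|z _ zP] := hasP (has_prim_root n_gt0 rn1 _ sz_r); last by exists z.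
by rewrite -separable_prod_XsubC -Dp separable_Xn_sub_1 // pnatr_eq0 -lt0n.
Qed.

(* Adjoining the [D+1] numbers [s z^i], [z] a primitive root of unity, changes
   the power sum of degree [D+1] and none of smaller degree. *)
Lemma power_sums_surjective (C : numClosedFieldType) D (u : nat -> C) :
  exists2 zs : seq C, size zs = (\sum_(k < D) k.+1)%N &
    forall r, (r < D)%N -> \sum_(z <- zs) z ^+ r.+1 = u r.
Proof.
elim: D => [|D [zs sz Hzs]]; first by exists [::]; rewrite // big_ord0.
have [x xP] := primitive_root_exists C (ltn0Sn D).
(* The new points add (D + 1) s^(D+1) in degree D + 1, which has to make up for the defect. *)
pose t := (u D - \sum_(z <- zs) z ^+ D.+1) / D.+1%:R.
pose s := D.+1.-root t.
exists (zs ++ [seq s * x ^+ i | i <- iota 0 D.+1]).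
  by rewrite size_cat size_map size_iota sz big_ord_recr.
move=> r; rewrite ltnS leq_eqVlt big_cat big_map big_iota_ord /=.
have -> : \sum_(i < D.+1) (s * x ^+ i) ^+ r.+1
   = s ^+ r.+1 * \sum_(i < D.+1) (x ^+ r.+1) ^+ i.
  by rewrite mulr_sumr; apply: eq_bigr => i _; rewrite exprMn -!exprM mulnC.
case/predU1P => [->|rD].
  rewrite (prim_expr_order xP) /s rootCK //.
  have -> : \sum_(i < D.+1) 1 ^+ i = D.+1%:R :> C.
    by under eq_bigr do rewrite expr1n; rewrite sumr_const card_ord.
  by rewrite /t divfK ?pnatr_eq0 // addrC subrK.
rewrite Hzs //; have -> : \sum_(i < D.+1) (x ^+ r.+1) ^+ i = 0; last by rewrite mulr0 addr0.
have ne1 : x ^+ r.+1 - 1 != 0.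
  rewrite subr_eq0 -(prim_order_dvd xP); apply/negP => /dvdn_leq; lia.
(* Geometric sum: multiplied by x^(r+1) - 1 it becomes x^((r+1)(D+1)) - 1 = 0. *)
apply: (mulfI ne1); rewrite -subrX1 mulr0 -exprM mulnC exprM.
by rewrite (prim_expr_order xP) expr1n subrr.
Qed.

Lemma lam_eq0_on_partitions (C : numClosedFieldType) (G : Lam C) m :
  (forall nu, is_part nu -> (m <= sumn nu)%N ->
    ev [seq (p%:R + 2^-1 : C) | p <- frob_p nu]
       [seq (q%:R + 2^-1 : C) | q <- frob_q nu] G = 0) -> G = 0.
Proof.
move=> vanish; apply: lam_eval_eq0 => v.
have [D D0 HD] := cmonom_bound (msupp G).
(* The number of points depends on [D] alone, so the shift by the [N] numbers -i - 1/2 can enter the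
   prescribed values before the points are chosen. *)
pose N := (\sum_(k < D) k.+1)%N.
have N0 : (0 < N)%N by rewrite /N -(prednK D0) big_ord_recl.
have [zs sz Hzs] :=
  power_sums_surjective D (fun r => v r + \sum_(i < N) (- i%:R - 2^-1) ^+ r.+1).
rewrite -[RHS](@vanish_free_rows _ _ _ vanish N zs [::]) //; last by rewrite addn0.
apply: (@eq_lam_eval _ _ D) => [m' m'G i|i iD]; first exact: (HD m' m'G i).2.
by rewrite big_ord0 addr0 Hzs // addrK.
Qed.

(** The equivalence asserts existence and uniqueness of the element FS_mu together with its
    value. *)
Theorem theorem3 (C : numClosedFieldType) (mu : seq nat) (F : Lam C) :
  is_part mu -> (FS_prop mu F <-> F = mpschur (@ahalf C) mu).
Proof.
move=> pm; have FS0 := FS_prop_mpschur C pm.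
split=> [FS|->//]; apply/eqP; rewrite -subr_eq0; apply/eqP.
apply: (@lam_eq0_on_partitions _ _ (sumn mu)) => nu pn le.
have ff0 : (sumn nu ^_ sumn mu)%:R != 0 :> C by rewrite pnatr_eq0 -lt0n ffact_gt0.
rewrite -[LHS]/(lam_eval _ _) rmorphB /= -[lam_eval _ F]/(ev _ _ _).
rewrite -[lam_eval _ (mpschur _ _)]/(ev _ _ _).
apply/eqP; rewrite subr_eq0; apply/eqP.
have i0 : (sumn nu ^_ sumn mu)%:R^-1 != 0 :> C by rewrite invr_eq0.
by apply: (mulIf i0); rewrite -FS // -FS0.
Qed.
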